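(* Let $\mathcal{H}$ be a separable Hilbert space with an orthogonal decomposition $\mathcal{H}=\bigoplus_{i\in I}\mathcal{K}_i$, where $I$ is an index set and the dimension of $\mathcal{K}_i$ does not depend on $i\in I$. Let $N=\bigoplus_{i\in I}\mathcal{B}(\mathcal{K}_i)\subseteq\mathcal{B}(\mathcal{H})$ (the block-diagonal operators) and let $\mathbb{E}_N:\mathcal{B}(\mathcal{H})\to N$ be the conditional expectation $\mathbb{E}_N(x)=\sum_{i\in I}p_ixp_i$, where $p_i$ is the orthogonal projection onto $\mathcal{K}_i$. Then the triple $(\mathcal{B}(\mathcal{H}),N,\mathbb{E}_N)$ has the relative Haagerup property.
   Context: For a faithful normal positive functional $\varphi$ on a von Neumann algebra $M$, $L^2(M,\varphi)$ is the GNS Hilbert space with cyclic vector $\Omega_\varphi$, and $M\subseteq \mathcal{B}(L^2(M,\varphi))$. A linear map $\Phi:M\to M$ has an $L^2$-implementation $\Phi^{(2)}$ with respect to $\varphi$ if $x\Omega_\varphi\mapsto\Phi(x)\Omega_\varphi$ extends to a bounded operator $\Phi^{(2)}$ on $L^2(M,\varphi)$. Let $N\subseteq M$ be a unital inclusion and let $\varphi$ be a faithful normal positive functional on $M$ whose modular group satisfies $\sigma_t^\varphi(N)\subseteq N$ for all $t\in\mathbb{R}$; equivalently there is a (unique) $\varphi$-preserving faithful normal conditional expectation $\mathbb{E}_N:M\to N$. Let $e_N=\mathbb{E}_N^{(2)}$ be the orthogonal projection of $L^2(M,\varphi)$ onto the closure of $N\Omega_\varphi$, let $\mathcal{K}_{00}(M,N,\varphi)=\mathrm{Span}\{xe_Ny: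 x,y\in M\}$, and let $\mathcal{K}(M,N,\varphi)$ be its operator-norm closure. The triple $(M,N,\varphi)$ has the relative Haagerup property (rHAP) if there is a net $(\Phi_i)_{i\in I}$ of normal maps $\Phi_i:M\to M$ such that: (1) each $\Phi_i$ is completely positive and $\sup_i\|\Phi_i\|<\infty$; (2) each $\Phi_i$ is an $N$-$N$-bimodule map; (3) $\Phi_i(x)\to x$ strongly for every $x\in M$; (4) $\varphi\circ\Phi_i\le\varphi$ for all $i$; (5) $\Phi_i^{(2)}\in\mathcal{K}(M,N,\varphi)$ for all $i$. For a faithful normal conditional expectation $\mathbb{E}_N:M\to N$, the triple $(M,N,\mathbb{E}_N)$ has the relative Haagerup property if $(M,N,\varphi)$ has it for some (equivalently, any) faithful normal positive functional $\varphi$ on $M$ with $\varphi\circ\mathbb{E}_N=\varphi$. *)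

(* Defs.v *)
From HB Require Import structures.
From mathcomp Require Import all_boot all_order all_algebra.
From mathcomp Require Import finmap complex.
From mathcomp Require Import all_classical all_reals all_analysis.
From mathcomp Require summability.

Set Implicit Arguments.
Unset Strict Implicit.
Unset Printing Implicit Defensive.

Import Order.TTheory GRing.Theory Num.Theory numFieldNormedType.Exports.

Local Open Scope classical_set_scope.
Local Open Scope card_scope.
Local Open Scope complex_scope.
Local Open Scope ring_scope.

(* The inner product is linear in the first variable.  Norms of a normed module
   over R[i] take values in R[i]. *)
HB.mixin Record hasInnerProduct (R : realType) H of NormedModule R[i] H := {
  dot : H -> H -> R[i];
  dotPl : forall (a : R[i]) (x y z : H),
    dot (a *: x + y) z = a * dot x z + dot y z;
  dotC : forall x y : H, dot y x = Num.conj (dot x y);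
  dot_norm : forall x : H, `|x| ^+ 2 = dot x x }.

#[short(type="hilbertType")]
HB.structure Definition Hilbert (R : realType) :=
  {H of CompleteNormedModule R[i] H & hasInnerProduct R H}.

Section HilbertSpaces.
Context {R : realType} {H : hilbertType R}.
Implicit Types (K B : set H) (S : set (H -> H)).

Definition lin_span {V : lmodType R[i]} (A : set V) : set V :=
  [set v | exists n (c : 'I_n -> R[i]) (w : 'I_n -> V),
     (forall k, A (w k)) /\ v = \sum_k c k *: w k].

Definition closed_subspace K : Prop :=
  [/\ K 0, forall (a : R[i]) x y, K x -> K y -> K (a *: x + y) & closed K].

Definition orthonormal_basis K B : Prop :=
  [/\ B `<=` K,
      forall x, B x -> dot x x = 1,
      forall x y, B x -> B y -> x <> y -> dot x y = 0 &
      closure (lin_span B) = K].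

Definition same_dim K L : Prop :=
  exists B C, [/\ orthonormal_basis K B, orthonormal_basis L C & B #= C].

Definition separable : Prop := exists D : set H, countable D /\ dense D.

Definition orthoproj K : H -> H :=
  fun x => get [set y | K y /\ forall z, K z -> dot (x - y) z = 0].

(* Operators are represented by their underlying functions, so that sums,
   scalings and compositions are those of functions. *)
Definition bounded_ops : set (H -> H) :=
  [set x | linear x /\ exists C : R[i], forall u, `|x u| <= C * `|u|].

Definition opnorm (x : H -> H) : R :=
  sup [set complex.Re `|x u| | u in [set u : H | `|u| <= 1]].

Definition adjoint (x y : H -> H) : Prop :=
  forall u v, dot (x u) v = dot u (y v).

Definition positive (x : H -> H) : Prop := forall u, 0 <= dot (x u) u.

(* positivity of an operator matrix, viewed as an operator on H^n *)
Definition positive_mx n (X : 'I_n -> 'I_n -> H -> H) : Prop :=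
  forall u : 'I_n -> H, 0 <= \sum_i \sum_j dot (X i j (u j)) (u i).

Definition commutant S : set (H -> H) :=
  [set y | bounded_ops y /\ forall x, S x -> y \o x = x \o y].

(* A self-adjoint set equal to its bicommutant is automatically a unital
   *-subalgebra of B(H). *)
Definition von_neumann_algebra S : Prop :=
  [/\ S `<=` bounded_ops,
      forall x, S x -> exists2 y, S y & adjoint x y &
      commutant (commutant S) = S].

Definition square_summable (u : nat -> H) : Prop :=
  cvgn (series (fun n => (`|u n| ^+ 2 : R[i]^o))).

(* convergence in the sigma-weak topology, which is generated by the
   functionals y |-> \sum_n <y (u n), v n> with u and v square summable *)
Definition sigma_weak_cvg (F : set_system (H -> H)) (x : H -> H) : Prop :=
  forall u v, square_summable u -> square_summable v ->
  limn (series (fun n => (dot (y (u n)) (v n) : R[i]^o))) @[y --> F] -->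
  limn (series (fun n => (dot (x (u n)) (v n) : R[i]^o))).

End HilbertSpaces.
Arguments separable {R} H.
Arguments bounded_ops {R} H.

Section Maps.
Context {R : realType} {H : hilbertType R}.
Implicit Types (M N : set (H -> H)) (Phi E : (H -> H) -> H -> H).
Implicit Types phi : (H -> H) -> R[i].

(* Only the values on M of maps and functionals on M are relevant. *)
Definition linear_on {V : lmodType R[i]} M (f : (H -> H) -> V) : Prop :=
  forall (a : R[i]) x y, M x -> M y -> f (a *: x + y) = a *: f x + f y.

Definition maps_into M N Phi : Prop := forall x, M x -> N (Phi x).

(* normal means sigma-weakly continuous *)
Definition normal_map M Phi : Prop :=
  forall (F : set_system (H -> H)) x, ProperFilter F -> F M -> M x ->
  sigma_weak_cvg F x -> sigma_weak_cvg (Phi @ F) (Phi x).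

Definition normal_functional M phi : Prop :=
  forall (F : set_system (H -> H)) x, ProperFilter F -> F M -> M x ->
  sigma_weak_cvg F x -> (phi y : R[i]^o) @[y --> F] --> (phi x : R[i]^o).

Definition faithful_normal_positive_functional M phi : Prop :=
  [/\ linear_on M (phi : (H -> H) -> R[i]^o),
      forall x, M x -> positive x -> 0 <= phi x,
      forall x, M x -> positive x -> phi x = 0 -> x = 0 &
      normal_functional M phi].

Definition completely_positive M Phi : Prop :=
  forall n (X : 'I_n -> 'I_n -> H -> H), (forall i j, M (X i j)) ->
  positive_mx X -> positive_mx (fun i j => Phi (X i j)).

Definition bimodule_map M N Phi : Prop :=
  forall a b x, N a -> N b -> M x -> Phi (a \o x \o b) = a \o Phi x \o b.

Record faithful_normal_cond_exp M N E : Prop := {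
  cond_exp_linear : linear_on M E;
  cond_exp_into : maps_into M N E;
  cond_exp_id : forall x, N x -> E x = x;
  cond_exp_bimodule : bimodule_map M N E;
  cond_exp_positive : forall x, M x -> positive x -> positive (E x);
  cond_exp_faithful : forall x, M x -> positive x -> E x = 0 -> x = 0;
  cond_exp_normal : normal_map M E }.

(* the GNS triple (L^2(M, phi), pi, Omega_phi), which is determined by these
   properties up to unitary equivalence *)
Record GNS M phi := {
  gns_space :> hilbertType R;
  gns_rep : (H -> H) -> gns_space -> gns_space;
  gns_vec : gns_space;
  gns_bounded : forall x, M x -> bounded_ops gns_space (gns_rep x);
  gns_linear : linear_on M gns_rep;
  gns_id : gns_rep id = id;
  gns_comp : forall x y, M x -> M y ->
    gns_rep (x \o y) = gns_rep x \o gns_rep y;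
  gns_adjoint : forall x y, M x -> M y -> adjoint x y ->
    adjoint (gns_rep x) (gns_rep y);
  gns_state : forall x, M x -> dot (gns_rep x gns_vec) gns_vec = phi x;
  gns_cyclic : closure [set gns_rep x gns_vec | x in M] = setT }.
Arguments gns_rep {M phi} g _ _.
Arguments gns_vec {M phi} g.

Section L2.
Variables (M N : set (H -> H)) (phi : (H -> H) -> R[i]) (L : GNS M phi).

Definition L2_implementation (Phi : (H -> H) -> H -> H) (T : L -> L) : Prop :=
  bounded_ops L T /\
  forall x, M x -> T (gns_rep L x (gns_vec L)) = gns_rep L (Phi x) (gns_vec L).

Definition jones_proj : L -> L :=
  orthoproj (closure [set gns_rep L x (gns_vec L) | x in N]).

Definition K00 : set (L -> L) :=
  lin_span [set T | exists x y, [/\ M x, M y &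
                      T = gns_rep L x \o jones_proj \o gns_rep L y]].

Definition Kcl : set (L -> L) :=
  [set T | bounded_ops L T /\
     forall eps : R, 0 < eps -> exists2 T0, K00 T0 & opnorm (T - T0) < eps].

End L2.

Definition directed_preorder (J : Type) (le : J -> J -> Prop) : Prop :=
  [/\ inhabited J, forall j, le j j,
      forall i j k, le i j -> le j k -> le i k &
      forall i j, exists2 k, le i k & le j k].

Definition tails (J : Type) (le : J -> J -> Prop) : set_system J :=
  [set A | exists j0, forall j, le j0 j -> A j].

Record rHAP_net M N phi (L : GNS M phi) (J : Type) (le : J -> J -> Prop)
    (Phi : J -> (H -> H) -> H -> H) : Prop := {
  rHAP_directed : directed_preorder le;
  rHAP_linear : forall j, linear_on M (Phi j);
  rHAP_into : forall j, maps_into M M (Phi j);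
  rHAP_normal : forall j, normal_map M (Phi j);
  rHAP_cp : forall j, completely_positive M (Phi j);
  rHAP_bounded : exists C : R, forall j x, M x ->
    opnorm (Phi j x) <= C * opnorm x;
  rHAP_bimodule : forall j, bimodule_map M N (Phi j);
  (* strong convergence, M being regarded as acting on L^2(M, phi) *)
  rHAP_strong : forall x (u : L), M x ->
    gns_rep L (Phi j x) u @[j --> tails le] --> gns_rep L x u;
  rHAP_contractive : forall j x, M x -> positive x -> phi (Phi j x) <= phi x;
  rHAP_compact : forall j, exists2 T,
    L2_implementation (L := L) (Phi j) T & Kcl N (L := L) T }.

Definition rHAP M N phi : Prop :=
  exists (L : GNS M phi) (J : Type) (le : J -> J -> Prop)
    (Phi : J -> (H -> H) -> H -> H), rHAP_net N L le Phi.

Definition relative_Haagerup_property M N E : Prop :=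
  [/\ von_neumann_algebra M, von_neumann_algebra N, N `<=` M,
      faithful_normal_cond_exp M N E &
      exists phi, [/\ faithful_normal_positive_functional M phi,
                      forall x, M x -> phi (E x) = phi x & rHAP M N phi]].

End Maps.

Section BlockDiagonal.
Context {R : realType} {H : hilbertType R} {I : choiceType}.
Variable K : I -> set H.

Definition orthogonal_decomposition : Prop :=
  [/\ forall i, closed_subspace (K i),
      forall i j u v, i <> j -> K i u -> K j v -> dot u v = 0 &
      closure (lin_span (\bigcup_i K i)) = setT].

Definition block_diagonal : set (H -> H) :=
  [set x | bounded_ops H x /\ forall i u, K i u -> K i (x u)].

(* the sum converges in the strong operator topology, i.e. pointwise *)
Definition block_exp (x : H -> H) : H -> H :=
  fun u => summability.sum (fun i => orthoproj (K i) (x (orthoproj (K i) u))).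

End BlockDiagonal.

(* Main.v *)
(* Take phi(x) = sum_n <x w_n, w_n> with w_n = 2^-n c_n for an orthonormal basis
   (c_n) of H adapted to the blocks K i; then phi o E_N = phi, and L^2(B(H), phi)
   is the space of square-summable sequences with cyclic vector (w_n).  For a
   finite set F of indices let p_F be the sum of the projections onto K i, i in F.
   As p_F is central in N, the compressions x |-> p_F x p_F are N-bimodule maps;
   they are completely positive, normal, decrease phi, and tend to the identity
   along F.  Since the blocks have equal dimensions, there are isometries y_ij
   from K i onto K j with left inverses u_ij, so that
   u_ij E_N(y_ij x) = p_i x p_j, and the compression by p_F is implemented
   exactly by the finite sum of the u_ij e_N y_ij with i, j in F.

   Normality of E_N: a sigma-weakly continuous functional is
   x |-> <(x (+) x (+) ...) f, g> for square-summable sequences f, g, and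
   composing it with E_N replaces f and g by the sequences of all their block
   components. *)
From HB Require Import structures.
Require Import Defs.
From mathcomp Require Import all_boot all_order all_algebra.
From mathcomp Require Import finmap complex.
From mathcomp Require Import all_classical all_reals all_analysis.
From mathcomp Require Import ring lra.
From mathcomp Require summability.

Set Implicit Arguments.
Unset Strict Implicit.
Unset Printing Implicit Defensive.

Import Order.TTheory GRing.Theory Num.Theory numFieldNormedType.Exports.

Local Open Scope classical_set_scope.
Local Open Scope complex_scope.
Local Open Scope ring_scope.

(** * Norms and limits over the complex numbers *)

(** A vector x Omega is recorded by its entries x w_n. The w_n are orthogonal and vanish only where
    c_n does, so finite sums of rank-one operators reach every finitely supported sequence; this
    makes Omega cyclic. It is separating, and phi faithful, because the c_n are total. The factors
    2^-n make (w_n) square-summable while staying nonzero. Each w_n lies in one block K_i(n), which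
    is the purpose of an adapted basis: N Omega is then dense in the sequences whose n-th entry lies
    in K_i(n), so e_N acts entrywise as p_i(n). Hence u_ij e_N y_ij acts as u_ij y_ij = p_i on the
    entries n with i(n) = j and kills all others. Summing over i, j in F leaves p_F on the entries
    with i(n) in F: the left factor of p_F x p_F acts on the values, the right one selects the
    positions. Identities between bounded maps are tested on vectors of the blocks, which span a
    dense subspace. On such a vector only one term of the sum defining E_N survives, so the infinite
    sum stays out of the algebra. *)

Lemma complex_gt0 {R : realType} (e : R[i]) :
  0 < e -> 0 < complex.Re e /\ e = (complex.Re e)%:C.
Proof. by case: e => a b; rewrite ltcE /= => /andP[/eqP-> ->]. Qed.

Section RealNorm.
Context {R : realType} {V : normedModType R[i]}.
Implicit Types x y : V.

Definition nrm x : R := complex.Re `|x|.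

Lemma nrmE x : `|x| = (nrm x)%:C.
Proof. by rewrite /nrm; have := normr_ge0 x; case: `|x| => a b; rewrite lecE /= => /andP[/eqP-> _]. Qed.

Lemma nrm_ge0 x : 0 <= nrm x.
Proof. by have := normr_ge0 x; rewrite nrmE lecR. Qed.

Lemma nrm0 : nrm (0 : V) = 0.
Proof. by rewrite /nrm normr0. Qed.

Lemma nrm_eq0 x : nrm x = 0 -> x = 0.
Proof. by move=> h; apply/eqP; rewrite -normr_eq0 nrmE h. Qed.

Lemma nrmD x y : nrm (x + y) <= nrm x + nrm y.
Proof. by have := ler_normD x y; rewrite !nrmE -rmorphD lecR. Qed.

Lemma nrmN x : nrm (- x) = nrm x.
Proof. by rewrite /nrm normrN. Qed.

Lemma nrmB x y : nrm (x - y) = nrm (y - x).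
Proof. by rewrite -nrmN opprB. Qed.

Lemma cvg_nrmP {T : Type} {F : set_system T} {FF : Filter F} (f : T -> V) (l : V) :
  f t @[t --> F] --> l <->
  (forall e : R, 0 < e -> \forall t \near F, nrm (l - f t) <= e).
Proof.
split=> [/cvgrPdist_le h e e0|h].
  have e0' : (0 : R[i]) < e%:C by rewrite ltcR.
  by apply: filterS (h _ e0') => t; rewrite nrmE lecR.
apply/cvgrPdist_le => e /complex_gt0[e1 ->].
by apply: filterS (h _ e1) => t; rewrite nrmE lecR.
Qed.

Lemma cvg_nrm_le {T : Type} {F : set_system T} {FF : ProperFilter F}
    (f : T -> V) (l : V) (B : R) :
  f t @[t --> F] --> l -> (\forall t \near F, nrm (f t) <= B) -> nrm l <= B.
Proof.
move=> /cvg_nrmP h hB; apply/ler_addgt0Pr => e e0.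
have [t [h1 h2]] := filter_ex (filterI (h e e0) hB).
rewrite -[l](subrK (f t)); apply: le_trans (nrmD _ _) _; rewrite addrC.
exact: lerD.
Qed.

Lemma cvg_lim_eq {T : Type} {F : set_system T} {FF : ProperFilter F}
    (f : T -> V) (l l' : V) :
  f t @[t --> F] --> l -> f t @[t --> F] --> l' -> l = l'.
Proof. by move=> h1 h2; apply: cvg_unique h1 h2; exact: norm_hausdorff. Qed.

Lemma eq_cvg_fun {T : Type} {F : set_system T} (f g : T -> V) (l : V) :
  f =1 g -> g t @[t --> F] --> l -> f t @[t --> F] --> l.
Proof. by move=> /funext ->. Qed.

Lemma cvg_scale {T : Type} {F : set_system T} {FF : Filter F} (a : R[i]) (f : T -> V) (l : V) :
  f t @[t --> F] --> l -> (a *: f t) @[t --> F] --> a *: l.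
Proof. exact: cvgZl_tmp. Qed.

Lemma closure_nrmP (A : set V) x :
  closure A x <-> forall e : R, 0 < e -> exists2 y, A y & nrm (x - y) <= e.
Proof.
split=> [h e e0|h B].
  have e0' : (0 : R[i]) < e%:C by rewrite ltcR.
  have [y [Ay By]] := h _ (nbhsx_ballx x _ e0').
  exists y => //; move: By; rewrite -ball_normE /= nrmE ltcR; exact: ltW.
move=> /nbhs_ballP[e /= /complex_gt0[e1 ee] he].
have [y Ay hy] := h (complex.Re e / 2) ltac:(lra).
exists y; split => //; apply: he; rewrite -ball_normE /= nrmE.
rewrite ee ltcR; lra.
Qed.

End RealNorm.
Arguments cvg_scale {R V T F FF} a {f l} _.

Lemma cvg_sum_seq {R : realType} {V : normedModType R[i]} {T : Type}
    {F : set_system T} {FF : Filter F} (J : Type) (s : seq J) (P : pred J)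
    (f : J -> T -> V) (l : J -> V) :
  (forall j, P j -> f j t @[t --> F] --> l j) ->
  (\sum_(j <- s | P j) f j t) @[t --> F] --> \sum_(j <- s | P j) l j.
Proof.
move=> h; elim: s => [|j s IH].
  rewrite big_nil; apply: (eq_cvg_fun (g := fun=> 0)) => [t|]; first by rewrite big_nil.
  exact: cvg_cst.
rewrite big_cons; apply: (eq_cvg_fun
    (g := fun t => (if P j then f j t else 0) + \sum_(j <- s | P j) f j t)) => [t|].
  by rewrite big_cons; case: ifP; rewrite ?add0r.
case: ifP => [Pj|_]; first exact: cvgD (h j Pj) IH.
by apply: (eq_cvg_fun _ IH) => t; rewrite add0r.
Qed.

Section ComplexNorm.
Context {R : realType}.
Implicit Types z : R[i].

Lemma nrmZ (V : normedModType R[i]) z (x : V) : nrm (z *: x) = nrm (z : R[i]^o) * nrm x.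
Proof.
apply: complexI; rewrite rmorphM /= -!nrmE normrZ; congr (_ * _).
Qed.

Lemma nrm_real (a : R) : nrm (a%:C : R[i]^o) = `|a|.
Proof. have -> : nrm (a%:C : R[i]^o) = complex.Re `|a%:C : R[i]| by [].
by rewrite normc_def /= expr0n /= addr0 sqrtr_sqr. Qed.

Lemma nrmM z z' : nrm (z * z' : R[i]^o) = nrm (z : R[i]^o) * nrm (z' : R[i]^o).
Proof. exact: nrmZ. Qed.

Lemma nrm_conj z : nrm (Num.conj z : R[i]^o) = nrm (z : R[i]^o).
Proof. by rewrite /nrm; congr complex.Re; exact: norm_conjC. Qed.

Lemma ge0_nrm z : 0 <= z -> z = (nrm (z : R[i]^o))%:C.
Proof. by move=> h; rewrite -nrmE ger0_norm. Qed.

(** The order of [R[i]] is partial, so the limit must also be shown to be real. It is shown to equal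
    its own norm, since [l - |l|] is the sum of [l - f t] and [|f t| - |l|], both small. *)
Lemma cvg_ge0 {T : Type} {F : set_system T} {FF : ProperFilter F}
    (f : T -> R[i]^o) (l : R[i]^o) :
  f t @[t --> F] --> l -> (\forall t \near F, 0 <= (f t : R[i])) -> 0 <= (l : R[i]).
Proof.
move=> /cvg_nrmP h h0; suff e : nrm (l - (nrm l)%:C) = 0.
  by move: (nrm_eq0 e) => /eqP; rewrite subr_eq0 => /eqP->; rewrite lecR nrm_ge0.
apply/eqP; rewrite eq_le nrm_ge0 andbT; apply/ler_addgt0Pr => e e0.
have e20 : 0 < e / 2 by rewrite divr_gt0.
have [t [h1 h2]] := filter_ex (filterI (h _ e20) h0).
have -> : l - (nrm l)%:C = (l - f t) + (nrm (f t) - nrm l)%:C.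
  by rewrite rmorphB /= -(ge0_nrm h2) addrA subrK.
apply: le_trans (nrmD _ _) _; rewrite nrm_real add0r.
have h3 : nrm l <= nrm (f t) + nrm (l - f t).
  by rewrite -{1}[l](subrK (f t)) addrC; exact: nrmD.
have h4 : nrm (f t) <= nrm l + nrm (l - f t).
  by rewrite nrmB -{1}[f t](subrK l) addrC; exact: nrmD.
have : `|nrm (f t) - nrm l| <= e / 2 by rewrite ler_norml; lra.
lra.
Qed.

Lemma cvg_conj {T : Type} {F : set_system T} {FF : Filter F}
    (f : T -> R[i]^o) (l : R[i]^o) :
  f t @[t --> F] --> l -> (Num.conj (f t) : R[i]^o) @[t --> F] --> (Num.conj l : R[i]^o).
Proof.
move=> /cvg_nrmP h; apply/cvg_nrmP => e e0.
by apply: filterS (h e e0) => t; rewrite -rmorphB nrm_conj.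
Qed.

Lemma cvg_realC {T : Type} {F : set_system T} {FF : Filter F}
    (f : T -> R) (l : R) :
  f t @[t --> F] --> l -> ((f t)%:C : R[i]^o) @[t --> F] --> (l%:C : R[i]^o).
Proof.
move=> /cvgrPdist_le h; apply/cvg_nrmP => e e0.
by apply: filterS (h e e0) => t; rewrite -rmorphB nrm_real.
Qed.

End ComplexNorm.

(** * Hermitian forms and bounded operators *)

Lemma ge0_conj {R : realType} (z : R[i]) : 0 <= z -> Num.conj z = z.
Proof. by move=> /ger0_real /CrealP. Qed.

Section HermitianForm.
Context {R : realType} {V : lmodType R[i]} (d : V -> V -> R[i]).
Hypothesis d_linear : forall a x y z, d (a *: x + y) z = a * d x z + d y z.
Hypothesis d_conj : forall x y, d y x = Num.conj (d x y).
Hypothesis d_ge0 : forall x, 0 <= d x x.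

Lemma hformDl x y z : d (x + y) z = d x z + d y z.
Proof. by rewrite -[x in LHS]scale1r d_linear mul1r. Qed.

Lemma hform0l z : d 0 z = 0.
Proof. by apply: (addrI (d 0 z)); rewrite -hformDl !addr0. Qed.

Lemma hformZl a x z : d (a *: x) z = a * d x z.
Proof. by rewrite -[_ *: _]addr0 d_linear hform0l addr0. Qed.

Lemma hformNl x z : d (- x) z = - d x z.
Proof. by rewrite -scaleN1r hformZl mulN1r. Qed.

Lemma hformBl x y z : d (x - y) z = d x z - d y z.
Proof. by rewrite hformDl hformNl. Qed.

Lemma hformDr x y z : d z (x + y) = d z x + d z y.
Proof. by rewrite d_conj hformDl rmorphD /= -!d_conj. Qed.

Lemma hform0r z : d z 0 = 0.
Proof. by rewrite d_conj hform0l rmorph0. Qed.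

Lemma hformZr a x z : d z (a *: x) = Num.conj a * d z x.
Proof. by rewrite d_conj hformZl rmorphM /= -d_conj. Qed.

Lemma hformNr x z : d z (- x) = - d z x.
Proof. by rewrite d_conj hformNl rmorphN /= -d_conj. Qed.

Lemma hformBr x y z : d z (x - y) = d z x - d z y.
Proof. by rewrite hformDr hformNr. Qed.

Lemma hform_suml (J : Type) (s : seq J) (P : pred J) (f : J -> V) z :
  d (\sum_(j <- s | P j) f j) z = \sum_(j <- s | P j) d (f j) z.
Proof. by apply: (big_morph (d^~ z) (id1 := 0)) => [x y|]; rewrite ?hformDl ?hform0l. Qed.

Lemma hform_sumr (J : Type) (s : seq J) (P : pred J) (f : J -> V) z :
  d z (\sum_(j <- s | P j) f j) = \sum_(j <- s | P j) d z (f j).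
Proof. by apply: (big_morph (d z) (id1 := 0)) => [x y|]; rewrite ?hformDr ?hform0r. Qed.

(** The form is only semidefinite, so that the possibly degenerate form [dot (x u) v] of a positive
    operator is covered. The inequality is the positivity of [d] at [a *: x - b *: y] with
    [a = d y y] and [b = d x y]; the case [d y y = 0] needs another choice. *)
Lemma hform_CauchySchwarz x y : `|d x y| ^+ 2 <= d x x * d y y.
Proof.
have key a b : 0 <= a * Num.conj a * d x x + b * Num.conj b * d y y
    - (a * Num.conj b * d x y + Num.conj (a * Num.conj b * d x y)).
  have := d_ge0 (a *: x - b *: y).
  rewrite hformBl !hformBr !hformZl !hformZr !rmorphM /= conjCK -(d_conj x y).
  set c := Num.conj a; set e := Num.conj b; set p := d x x.
  set q := d x y; set r := d y x; set s := d y y.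
  by congr (_ <= _); ring.
have pp := normCK (d x y).
have cx := ge0_conj (d_ge0 x); have cy := ge0_conj (d_ge0 y).
have := d_ge0 y; rewrite le_eqVlt => /orP[/eqP y0|y0].
  rewrite -y0 mulr0 pp; set m := _ * _.
  have m0 : 0 <= m by rewrite /m -pp exprn_ge0.
  move: (m0); rewrite le_eqVlt => /orP[/eqP<-//|m1].
  have cm := ge0_conj m0.
  (* With [a = 1] and [b = t * d x y] the form takes the value [d x x - 2 * (t * m)]; this [t] makes
     it [- d x x - 2], which is negative. *)
  have [t ct tm] : exists2 t : R[i], Num.conj t = t & t * m = d x x + 1.
    exists ((d x x + 1) / m); last by rewrite mulfVK// gt_eqF.
    by apply: ge0_conj; rewrite divr_ge0// addr_ge0.
  have := key 1 (t * d x y); rewrite -y0 mulr0 addr0 rmorph1 !mul1r.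
  rewrite !rmorphM /= !conjCK !ct.
  have -> : d x x - (t * Num.conj (d x y) * d x y + t * d x y * Num.conj (d x y))
     = d x x - 2 * (t * m) by rewrite /m; ring.
  rewrite tm => h.
  have : 0 <= - (d x x) - 2 by apply: le_trans h _; rewrite le_eqVlt; apply/orP; left; apply/eqP; ring.
  have h2 : - d x x - 2 < 0.
    rewrite -opprD oppr_lt0; apply: ltr_wpDl => //.
  by move=> /(le_lt_trans)/(_ h2); rewrite ltxx.
have := key (d y y) (d x y); rewrite !rmorphM /= !conjCK !cy.
have -> : d y y * d y y * d x x + d x y * Num.conj (d x y) * d y y -
  (d y y * Num.conj (d x y) * d x y + d y y * d x y * Num.conj (d x y))
  = d y y * (d x x * d y y - d x y * Num.conj (d x y)) by ring.
by rewrite pmulr_rge0// subr_ge0 pp.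
Qed.

End HermitianForm.

Section HilbertBasics.
Context {R : realType} {H : hilbertType R}.
Implicit Types x y z : H.

Lemma dot_ge0 x : 0 <= dot x x.
Proof. by rewrite -dot_norm exprn_ge0. Qed.

Lemma dotxx x : dot x x = (nrm x ^+ 2)%:C.
Proof. by rewrite -dot_norm nrmE rmorphXn. Qed.

Lemma dotDl x y z : dot (x + y) z = dot x z + dot y z.
Proof. exact: (hformDl (@dotPl R H)). Qed.
Lemma dotDr x y z : dot z (x + y) = dot z x + dot z y.
Proof. exact: (hformDr (@dotPl R H) (@dotC R H)). Qed.
Lemma dotBl x y z : dot (x - y) z = dot x z - dot y z.
Proof. exact: (hformBl (@dotPl R H)). Qed.
Lemma dotBr x y z : dot z (x - y) = dot z x - dot z y.
Proof. exact: (hformBr (@dotPl R H) (@dotC R H)). Qed.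
Lemma dot0l z : dot 0 z = 0.
Proof. exact: (hform0l (@dotPl R H)). Qed.
Lemma dot0r z : dot z 0 = 0.
Proof. exact: (hform0r (@dotPl R H) (@dotC R H)). Qed.
Lemma dotZl a x z : dot (a *: x) z = a * dot x z.
Proof. exact: (hformZl (@dotPl R H)). Qed.
Lemma dotZr a x z : dot z (a *: x) = Num.conj a * dot z x.
Proof. exact: (hformZr (@dotPl R H) (@dotC R H)). Qed.
Lemma dot_suml (J : Type) (s : seq J) (P : pred J) (f : J -> H) z :
  dot (\sum_(j <- s | P j) f j) z = \sum_(j <- s | P j) dot (f j) z.
Proof. exact: (hform_suml (@dotPl R H)). Qed.
Lemma dot_sumr (J : Type) (s : seq J) (P : pred J) (f : J -> H) z :
  dot z (\sum_(j <- s | P j) f j) = \sum_(j <- s | P j) dot z (f j).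
Proof. exact: (hform_sumr (@dotPl R H) (@dotC R H)). Qed.

Lemma dot_sym0 x y : dot x y = 0 -> dot y x = 0.
Proof. by move=> h; rewrite dotC h rmorph0. Qed.

Lemma dotxx_eq0 x : dot x x = 0 -> x = 0.
Proof.
rewrite dotxx => /(@complexI R _ 0)/eqP; rewrite sqrf_eq0 => /eqP.
exact: nrm_eq0.
Qed.

Lemma dot_CauchySchwarz x y : nrm (dot x y : R[i]^o) <= nrm x * nrm y.
Proof.
have := hform_CauchySchwarz (@dotPl R H) (@dotC R H) dot_ge0 x y.
have -> : `|dot x y| = (nrm (dot x y : R[i]^o))%:C by exact: (nrmE (dot x y : R[i]^o)).
rewrite !dotxx -rmorphXn -rmorphM lecR -exprMn ler_pXn2r// nnegrE ?nrm_ge0//.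
by rewrite mulr_ge0 ?nrm_ge0.
Qed.

Lemma pythagoras x y : dot x y = 0 -> nrm (x + y) ^+ 2 = nrm x ^+ 2 + nrm y ^+ 2.
Proof.
move=> h; apply: complexI; rewrite rmorphD /= -!dotxx dotDl !dotDr h (dot_sym0 h).
by rewrite addr0 add0r.
Qed.

Lemma pythagoras_sum (J : eqType) (s : seq J) (f : J -> H) : uniq s ->
  (forall i j, i \in s -> j \in s -> i != j -> dot (f i) (f j) = 0) ->
  nrm (\sum_(j <- s) f j) ^+ 2 = \sum_(j <- s) nrm (f j) ^+ 2.
Proof.
elim: s => [|a s IH] /=; first by rewrite !big_nil nrm0 expr0n.
move=> /andP[a_s us] h; rewrite !big_cons pythagoras ?IH//.
  by move=> i j i_s j_s; apply: h; rewrite inE ?i_s ?j_s orbT.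
rewrite dot_sumr big_seq big1// => j js; apply: h; rewrite ?inE ?eqxx ?js ?orbT//.
by apply: contraNneq a_s => ->.
Qed.

Lemma cvg_dotl {T : Type} {F : set_system T} {FF : Filter F} (f : T -> H) x y :
  f t @[t --> F] --> x -> (dot (f t) y : R[i]^o) @[t --> F] --> (dot x y : R[i]^o).
Proof.
move=> /cvg_nrmP h; apply/cvg_nrmP => e e0.
have B0 : 0 < nrm y + 1 by rewrite ltr_wpDl ?nrm_ge0.
have e1 : 0 < e / (nrm y + 1) by rewrite divr_gt0.
apply: filterS (h _ e1) => t ht; rewrite -dotBl.
apply: le_trans (dot_CauchySchwarz _ _) _.
apply: (@le_trans _ _ (e / (nrm y + 1) * (nrm y + 1))).
  by apply: ler_pM; rewrite ?nrm_ge0// lerDl.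
by rewrite mulfVK// gt_eqF.
Qed.

Lemma cvg_dotr {T : Type} {F : set_system T} {FF : Filter F} (f : T -> H) x y :
  f t @[t --> F] --> x -> (dot y (f t) : R[i]^o) @[t --> F] --> (dot y x : R[i]^o).
Proof.
move=> h; rewrite (dotC x y); under eq_fun do rewrite dotC.
exact/cvg_conj/cvg_dotl.
Qed.

End HilbertBasics.

Section BoundedOps.
Context {R : realType} {H H' : normedModType R[i]}.

(* the bound is taken real, unlike in [bounded_ops], so that it can be
   manipulated by real arithmetic *)
Definition bounded (x : H -> H') : Prop :=
  linear x /\ exists2 C : R, 0 <= C & forall u, nrm (x u) <= C * nrm u.

Section linear.
Variable x : H -> H'.
Hypothesis lx : linear x.

Lemma lin0 : x 0 = 0.
Proof. by have := lx (-1) 0 0; rewrite scaler0 addr0 scaleN1r addNr. Qed.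
Lemma linD u v : x (u + v) = x u + x v.
Proof. by have := lx 1 u v; rewrite !scale1r. Qed.
Lemma linZ a u : x (a *: u) = a *: x u.
Proof. by have := lx a u 0; rewrite lin0 !addr0. Qed.
Lemma linN u : x (- u) = - x u.
Proof. by rewrite -[- u]scaleN1r linZ scaleN1r. Qed.
Lemma linB u v : x (u - v) = x u - x v.
Proof. by rewrite linD linN. Qed.
Lemma lin_sum (J : Type) (s : seq J) (P : pred J) (f : J -> H) :
  x (\sum_(j <- s | P j) f j) = \sum_(j <- s | P j) x (f j).
Proof. by apply: (big_morph x (id1 := 0)) => [u v|]; rewrite ?linD ?lin0. Qed.
End linear.

Lemma bounded_cvg (x : H -> H') {T : Type} {F : set_system T} {FF : Filter F} (f : T -> H) u :
  bounded x -> f t @[t --> F] --> u -> x (f t) @[t --> F] --> x u.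
Proof.
move=> [lx [C C0 hC]] /cvg_nrmP h; apply/cvg_nrmP => e e0.
have B0 : 0 < C + 1 by rewrite ltr_wpDl.
have e1 : 0 < e / (C + 1) by rewrite divr_gt0.
apply: filterS (h _ e1) => t ht; rewrite -linB//.
apply: le_trans (hC _) _.
apply: (@le_trans _ _ ((C + 1) * (e / (C + 1)))).
  by apply: ler_pM; rewrite ?nrm_ge0// lerDl.
by rewrite mulrC mulfVK// gt_eqF.
Qed.

Lemma closure_bounded (A : set H) (B : set H') (x : H -> H') : bounded x ->
  (forall a, A a -> B (x a)) -> forall u, closure A u -> closure B (x u).
Proof.
move=> [lx [C C0 hC]] h u /closure_nrmP hu; apply/closure_nrmP => e e0.
have B0 : 0 < C + 1 by rewrite ltr_wpDl.
have e1 : 0 < e / (C + 1) by rewrite divr_gt0.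
have [a Aa ha] := hu _ e1; exists (x a); first exact: h.
rewrite -linB//; apply: le_trans (hC _) _.
apply: (@le_trans _ _ ((C + 1) * (e / (C + 1)))).
  by apply: ler_pM; rewrite ?nrm_ge0// lerDl.
by rewrite mulrC mulfVK// gt_eqF.
Qed.

Lemma bounded_eq (A : set H) (x y : H -> H') : bounded x -> bounded y ->
  (forall a, A a -> x a = y a) -> forall u, closure (lin_span A) u -> x u = y u.
Proof.
move=> [lx [C C0 hC]] [ly [D D0 hD]] h u /closure_nrmP hu.
apply/eqP; rewrite -subr_eq0; apply/eqP/nrm_eq0/eqP.
rewrite eq_le nrm_ge0 andbT; apply/ler_addgt0Pr => e e0.
have B0 : 0 < C + D + 1 by rewrite ltr_wpDl// addr_ge0.
have e1 : 0 < e / (C + D + 1) by rewrite divr_gt0.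
have [a [n [c [w [hw aE]]]] ha] := hu _ e1; rewrite add0r.
have xya : x a = y a.
  rewrite aE !lin_sum//; apply: eq_bigr => k _.
  by rewrite !linZ// h.
have -> : x u - y u = x (u - a) - y (u - a).
  by rewrite !linB// xya opprB addrA subrK.
apply: le_trans (nrmD _ _) _; rewrite nrmN.
apply: le_trans (lerD (hC _) (hD _)) _; rewrite -mulrDl.
apply: (@le_trans _ _ ((C + D + 1) * (e / (C + D + 1)))).
  by apply: ler_pM; rewrite ?nrm_ge0 ?addr_ge0// lerDl.
by rewrite mulrC mulfVK// gt_eqF.
Qed.

Lemma bounded_eqT (A : set H) (x y : H -> H') : bounded x -> bounded y ->
  closure (lin_span A) = setT -> (forall a, A a -> x a = y a) -> x = y.
Proof.
move=> bx by_ hA h; apply/funext => u; apply: (bounded_eq bx by_ h).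
by rewrite hA.
Qed.

Lemma bounded_lin (x : H -> H') : bounded x -> linear x.
Proof. by case. Qed.

Lemma bounded0 : bounded (fun _ => 0).
Proof.
split; first by move=> a u v; rewrite scaler0 addr0.
by exists 0 => // u; rewrite nrm0 mul0r.
Qed.

Lemma boundedP (a : R[i]) (x y : H -> H') : bounded x -> bounded y -> bounded (a *: x + y).
Proof.
move=> [lx [C C0 hC]] [ly [D D0 hD]]; split.
  move=> b u v; rewrite /= !fctE /= lx ly; rewrite !scalerDr !scalerA [a * b]mulrC.
  by rewrite addrACA.
exists (nrm (a : R[i]^o) * C + D) => [|u]; first by rewrite addr_ge0// mulr_ge0// nrm_ge0.
apply: le_trans (nrmD _ _) _; rewrite mulrDl; apply: lerD => //.
by rewrite -[_ u]/(a *: x u) nrmZ -mulrA ler_wpM2l ?nrm_ge0.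
Qed.

End BoundedOps.

(** A set whose span is dense has this property. The codomain is quantified because both operators
    and scalar functionals are compared in this way. *)
Definition determining {R : realType} {H : normedModType R[i]} (A : set H) : Prop :=
  forall (V : normedModType R[i]) (x y : H -> V), bounded x -> bounded y ->
  (forall a, A a -> x a = y a) -> x = y.

Section BoundedOps2.
Context {R : realType} {H : hilbertType R}.
Implicit Types x y : H -> H.

Lemma bounded_opsP x : bounded_ops H x <-> bounded x.
Proof.
split=> [[lx [C hC]]|[lx [C C0 hC]]]; split=> //.
  (* On the zero space [C] may be any complex number, so its modulus is the bound. *)
  exists (nrm (C : R[i]^o)) => [|u]; first exact: nrm_ge0.
  have h0 : 0 <= C * `|u| := le_trans (normr_ge0 _) (hC u).
  have e : C * `|u| = (nrm (C : R[i]^o) * nrm u)%:C.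
    by rewrite (ge0_nrm h0) nrmM (nrmE u) nrm_real ger0_norm// nrm_ge0.
  by have := hC u; rewrite e nrmE lecR.
by exists C%:C => u; rewrite !nrmE -rmorphM lecR.
Qed.

Lemma bounded_comp {H1 H2 H3 : normedModType R[i]} (x : H2 -> H3) (y : H1 -> H2) :
  bounded x -> bounded y -> bounded (x \o y).
Proof.
move=> [lx [C C0 hC]] [ly [D D0 hD]]; split.
  by move=> a u v /=; rewrite ly lx.
exists (C * D) => [|u /=]; first exact: mulr_ge0.
by apply: le_trans (hC _) _; rewrite -mulrA ler_wpM2l.
Qed.

Lemma bounded_id : bounded (@id H).
Proof. by split=> //; exists 1 => // u; rewrite mul1r. Qed.

Lemma bounded_dotl (H' : normedModType R[i]) (x : H' -> H) v : bounded x ->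
  bounded (fun u => dot (x u) v : R[i]^o).
Proof.
move=> [lx [C C0 hC]]; split; first by move=> a u w; rewrite lx dotPl.
exists (C * nrm v) => [|u]; first by rewrite mulr_ge0// nrm_ge0.
apply: le_trans (dot_CauchySchwarz _ _) _.
by rewrite mulrAC ler_wpM2r ?nrm_ge0.
Qed.

Lemma bounded_sum (J : Type) (s : seq J) (x : J -> H -> H) :
  (forall j, bounded (x j)) -> bounded (\sum_(j <- s) x j).
Proof.
move=> h; elim: s => [|a s IH]; first by rewrite big_nil; exact: bounded0.
by rewrite big_cons -[x a]scale1r; exact: boundedP.
Qed.

(** Polarization over the complex numbers: reality of [dot (x w) w] at [w = u + v] controls the sum
    of the two mixed terms, and at [w = u + 'i *: v] their difference. *)
Lemma positive_herm x : linear x -> positive x ->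
  forall u v, dot (x v) u = Num.conj (dot (x u) v).
Proof.
move=> lx px u v.
have h1 := ge0_conj (px (u + v)).
have h2 := ge0_conj (px (u + 'i *: v)).
have hu := ge0_conj (px u). have hv := ge0_conj (px v).
move: h1 h2; rewrite !linD// !dotDl !dotDr !linZ// !dotZl !dotZr !rmorphD !rmorphM /= !conjCK.
rewrite hu hv !conjCi.
set a := dot (x u) v; set b := dot (x v) u.
set p := dot (x u) u; set q := dot (x v) v.
set a' := Num.conj a; set b' := Num.conj b.
move=> h1 h2.
have i0 : ('i : R[i]) != 0 by exact: neq0Ci.
have e1 : a' + b' = a + b.
  have : p + a' + (b' + q) - p - q = p + a + (b + q) - p - q by rewrite h1.
  by move=> e; transitivity (p + a' + (b' + q) - p - q); [ring | rewrite e; ring].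
have e2 : 'i * (a' - b') = 'i * (b - a).
  move: h2 => /(congr1 (fun z => z - p + 'i * 'i * q)) h2.
  transitivity (p + 'i * a' + (- 'i * b' + - 'i * ('i * q)) - p + 'i * 'i * q); first by ring.
  by rewrite h2; ring.
move/(mulfI i0): e2 => e2.
have : 2 * b = 2 * a'.
  transitivity ((a + b) + (b - a)); first by ring.
  by rewrite -e1 -e2; ring.
by move/mulfI; apply; rewrite pnatr_eq0.
Qed.

(** Cauchy-Schwarz for the form [dot (x u) v], applied to [u] and [x u], bounds the square of
    [dot (x u) (x u)] by a multiple of [dot (x u) u]. *)
Lemma positive_eq0 x u : linear x -> positive x -> dot (x u) u = 0 -> x u = 0.
Proof.
move=> lx px h0.
have h := @hform_CauchySchwarz R H (fun u v => dot (x u) v) _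
  (positive_herm lx px) px u (x u).
have {}h := h ltac:(by move=> a v w z; rewrite lx dotPl).
apply: dotxx_eq0; apply/eqP; rewrite -normr_eq0 -sqrf_eq0.
by rewrite eq_le exprn_ge0// andbT; move: h; rewrite h0 mul0r.
Qed.

End BoundedOps2.

(** * The Hilbert space of square-summable sequences *)

Section SquareSummable.
Context {R : realType} {H : hilbertType R}.
Implicit Types f g : nat -> H.

Definition l2bounded f : Prop :=
  exists B : R, forall N, \sum_(0 <= n < N) nrm (f n) ^+ 2 <= B.

Definition sumsq f : R := limn (series (fun n => nrm (f n) ^+ 2)).

Definition l2dot f g : R[i] := limn (series (fun n => (dot (f n) (g n) : R[i]^o))).

Lemma l2bounded0 : l2bounded (0 : nat -> H).
Proof.
by exists 0 => N; rewrite big1// => n _; rewrite -[(0 : nat -> H) n]/(0 : H) nrm0 expr0n.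
Qed.

Lemma nrm_lin2 (a : R[i]) (x y : H) :
  nrm (a *: x + y) ^+ 2 <= 2 * nrm (a : R[i]^o) ^+ 2 * nrm x ^+ 2 + 2 * nrm y ^+ 2.
Proof.
have h := nrmD (a *: x) y; rewrite nrmZ in h.
set p := nrm (a : R[i]^o) in h *; set q := nrm x in h *; set r := nrm y in h *.
have h0 : 0 <= nrm (a *: x + y) by exact: nrm_ge0.
apply: (@le_trans _ _ ((p * q + r) ^+ 2)).
  by rewrite ler_pXn2r// nnegrE// addr_ge0 ?mulr_ge0// ?nrm_ge0.
rewrite -subr_ge0.
have -> : 2 * p ^+ 2 * q ^+ 2 + 2 * r ^+ 2 - (p * q + r) ^+ 2 = (p * q - r) ^+ 2 by ring.
exact: sqr_ge0.
Qed.

Lemma l2boundedP (a : R[i]) f g : l2bounded f -> l2bounded g -> l2bounded (a *: f + g).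
Proof.
move=> [B hB] [C hC]; exists (2 * nrm (a : R[i]^o) ^+ 2 * B + 2 * C) => N.
apply: (@le_trans _ _ (\sum_(0 <= n < N) (2 * nrm (a : R[i]^o) ^+ 2 * nrm (f n) ^+ 2
   + 2 * nrm (g n) ^+ 2))).
  by apply: ler_sum => n _; exact: nrm_lin2.
rewrite big_split /= -!mulr_sumr; apply: lerD; apply: ler_wpM2l => //.
by rewrite mulr_ge0 ?sqr_ge0.
Qed.

Lemma cvg_sumsq f : l2bounded f ->
  series (fun n => nrm (f n) ^+ 2) n @[n --> \oo] --> sumsq f.
Proof.
move=> [B hB]; apply: nondecreasing_is_cvgn.
  apply/nondecreasing_seqP => n; rewrite /series /= big_nat_recr//=.
  by rewrite lerDl sqr_ge0.
by exists B => _ [n _ <-]; exact: hB.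
Qed.

Lemma sumsq_ge f N : l2bounded f -> \sum_(0 <= n < N) nrm (f n) ^+ 2 <= sumsq f.
Proof.
move=> hf; apply: (@nondecreasing_cvgn_le _ (series (fun n => nrm (f n) ^+ 2))).
  apply/nondecreasing_seqP => n; rewrite /series /= big_nat_recr//=.
  by rewrite lerDl sqr_ge0.
exact: cvgP (cvg_sumsq hf).
Qed.

Lemma sumsq_le f (B : R) : l2bounded f ->
  (forall N, \sum_(0 <= n < N) nrm (f n) ^+ 2 <= B) -> sumsq f <= B.
Proof.
move=> hf h; apply: limr_le; first exact: cvgP (cvg_sumsq hf).
by near=> n; exact: h.
Unshelve. all: by end_near. Qed.

Lemma polarization (x y : H) : 4 * dot x y =
  (nrm (x + y) ^+ 2)%:C - (nrm (-1 *: y + x) ^+ 2)%:C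
  + 'i * (nrm ('i *: y + x) ^+ 2)%:C - 'i * (nrm (- 'i *: y + x) ^+ 2)%:C.
Proof.
rewrite -!dotxx !dotDl !dotDr !dotZl !dotZr !rmorphN /= !conjCi rmorph1.
set a := dot x x; set b := dot x y; set c := dot y x; set e := dot y y.
have ii : ('i : R[i]) * 'i = -1 by rewrite -expr2 sqrCi.
apply/eqP; rewrite -subr_eq0; apply/eqP.
transitivity ((2 * b - 2 * c) * ('i * 'i + 1)); first by ring.
by rewrite ii addNr mulr0.
Qed.

(** By polarization the series is a combination of four series of squared norms, each of which is
    nondecreasing and bounded. *)
Lemma cvg_l2dot f g : l2bounded f -> l2bounded g ->
  (series (fun n => (dot (f n) (g n) : R[i]^o)) n : R[i]^o) @[n --> \oo]
    --> (l2dot f g : R[i]^o).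
Proof.
move=> hf hg.
have e (a : R[i]) : (\sum_(0 <= k < n) (nrm (a *: g k + f k) ^+ 2)%:C : R[i]^o) @[n --> \oo]
    --> ((sumsq (a *: g + f))%:C : R[i]^o).
  apply: (eq_cvg_fun (V := R[i]^o) _ (cvg_realC (cvg_sumsq (l2boundedP a hg hf)))) => n.
  by rewrite /series /= rmorph_sum.
suff : cvgn (series (fun n => (dot (f n) (g n) : R[i]^o))) by [].
have -> : series (fun n => (dot (f n) (g n) : R[i]^o)) =
  fun n => 4^-1 *: (\sum_(0 <= k < n) (nrm (1 *: g k + f k) ^+ 2)%:C -
    \sum_(0 <= k < n) (nrm (-1 *: g k + f k) ^+ 2)%:C +
    'i *: (\sum_(0 <= k < n) (nrm ('i *: g k + f k) ^+ 2)%:C : R[i]^o) -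
    'i *: (\sum_(0 <= k < n) (nrm (- 'i *: g k + f k) ^+ 2)%:C : R[i]^o)) :> R[i]^o.
  apply/funext => n; rewrite /series /=.
  rewrite !scaler_sumr -sumrB -big_split /= -sumrB scaler_sumr.
  apply: eq_bigr => k _; rewrite scale1r [g k + f k]addrC.
  have p4 := polarization (f k) (g k).
  rewrite -[_ *: _]/(4^-1 * _) -p4 mulKf// pnatr_eq0//.
exact: cvgP (cvg_scale 4^-1 (cvgB (cvgD (cvgB (e 1) (e (-1)))
  (cvg_scale 'i (e 'i))) (cvg_scale 'i (e (- 'i))))).
Qed.

Lemma l2dotP (a : R[i]) f g h : l2bounded f -> l2bounded g -> l2bounded h ->
  l2dot (a *: f + g) h = a * l2dot f h + l2dot g h.
Proof.
move=> hf hg hh.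
apply: (cvg_lim_eq (V := R[i]^o) (cvg_l2dot (l2boundedP a hf hg) hh)).
apply: (eq_cvg_fun (V := R[i]^o) _
  (cvgD (cvg_scale a (cvg_l2dot hf hh)) (cvg_l2dot hg hh))) => n.
rewrite /series /= scaler_sumr -big_split /=; apply: eq_bigr => k _.
by rewrite dotPl.
Qed.

Lemma l2dotC f g : l2bounded f -> l2bounded g -> l2dot g f = Num.conj (l2dot f g).
Proof.
move=> hf hg.
apply: (cvg_lim_eq (V := R[i]^o) (cvg_l2dot hg hf)).
apply: (eq_cvg_fun (V := R[i]^o) _ (cvg_conj (cvg_l2dot hf hg))) => n.
by rewrite /series /= rmorph_sum /=; apply: eq_bigr => k _; rewrite dotC.
Qed.

Lemma l2dotxx f : l2bounded f -> l2dot f f = (sumsq f)%:C.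
Proof.
move=> hf; apply: (cvg_lim_eq (V := R[i]^o) (cvg_l2dot hf hf)).
apply: (eq_cvg_fun (V := R[i]^o) _ (cvg_realC (cvg_sumsq hf))) => n.
by rewrite /series /= rmorph_sum /=; apply: eq_bigr => k _; rewrite dotxx.
Qed.

Lemma square_summableP f : square_summable f <-> l2bounded f.
Proof.
have e n : series (fun n => (`|f n| ^+ 2 : R[i]^o)) n = (\sum_(0 <= k < n) nrm (f k) ^+ 2)%:C.
  by rewrite /series /= rmorph_sum; apply: eq_bigr => k _; rewrite nrmE rmorphXn.
split=> [|hf].
  rewrite /square_summable => /cvg_ex[/= l hl].
  exists (nrm l) => N.
  (* The limit [l] is a complex number; dominating the partial sums in the order of [R[i]] forces it
     to be real and nonnegative. *)
  have h0 : 0 <= l - (\sum_(0 <= k < N) nrm (f k) ^+ 2)%:C.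
    apply: (cvg_ge0 (cvgB hl (cvg_cst ((\sum_(0 <= k < N) nrm (f k) ^+ 2)%:C : R[i]^o)))).
    near=> n; rewrite e subr_ge0 lecR.
    rewrite (@big_cat_nat _ _ _ N 0 n)//=; last by near: n; exact: nbhs_infty_ge.
    by rewrite lerDl sumr_ge0// => i _; rewrite sqr_ge0.
  have l0 : 0 <= l.
    rewrite -(subrK (\sum_(0 <= k < N) nrm (f k) ^+ 2)%:C l) addr_ge0// lecR.
    by rewrite sumr_ge0// => i _; rewrite sqr_ge0.
  by move: h0; rewrite (ge0_nrm l0) nrm_real ger0_norm ?nrm_ge0// subr_ge0 lecR.
apply/cvg_ex; exists ((sumsq f)%:C).
apply: (eq_cvg_fun (V := R[i]^o) _ (cvg_realC (cvg_sumsq hf))) => n.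
exact: e.
Unshelve. all: by end_near. Qed.

End SquareSummable.

Section L2Space.
Context {R : realType} (S : pred nat) (H : hilbertType R).

Definition l2pred : {pred nat -> H} :=
  fun f => `[< (forall n, ~~ S n -> f n = 0) /\ l2bounded f >].

(* [S] makes a sequence vanishing exactly outside of [S] a possible cyclic vector *)
Record l2 := L2 { l2val :> nat -> H; l2valP : l2val \in l2pred }.

Arguments l2val : simpl never.
HB.instance Definition _ := [isSub for l2val].
HB.instance Definition _ := [Choice of l2 by <:].

Lemma l2pred_submod : submod_closed l2pred.
Proof.
split; first by apply/asboolP; split=> //; exact: l2bounded0.
move=> a f g /asboolP[f0 hf] /asboolP[g0 hg]; apply/asboolP; split.
  by move=> n Sn; rewrite !fctE f0// g0// scaler0 addr0.
exact: l2boundedP.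
Qed.
HB.instance Definition _ := GRing.isSubmodClosed.Build R[i] (nat -> H) l2pred l2pred_submod.
HB.instance Definition _ := [SubChoice_isSubLmodule of l2 by <:].

Lemma l2_bounded (f : l2) : l2bounded f.
Proof. by have /asboolP[] := l2valP f. Qed.

Lemma l2_supp (f : l2) n : ~~ S n -> f n = 0.
Proof. by have /asboolP[h _] := l2valP f; exact: h. Qed.

Lemma l2_ext (f g : l2) : (forall n, S n -> f n = g n) -> f = g.
Proof.
move=> h; apply/val_inj/funext => n /=; have [/h//|Sn] := boolP (S n).
by rewrite !l2_supp.
Qed.

Lemma l2_linE a (f g : l2) : (a *: f + g : l2) = a *: (f : nat -> H) + g :> (nat -> H).
Proof. by []. Qed.

Lemma l2valD (f g : l2) n : (f + g) n = f n + g n. Proof. by []. Qed.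
Lemma l2valZ a (f : l2) n : (a *: f) n = a *: f n. Proof. by []. Qed.
Lemma l2valB (f g : l2) n : (f - g) n = f n - g n. Proof. by []. Qed.
Lemma l2val_sum (J : Type) (s : seq J) (P : pred J) (F : J -> l2) n :
  (\sum_(j <- s | P j) F j) n = \sum_(j <- s | P j) F j n.
Proof. by apply: (big_morph (fun f : l2 => f n) (id1 := 0)). Qed.

Definition l2norm (f : l2) : R[i] := (Num.sqrt (sumsq f))%:C.

Lemma sumsq_ge0 (f : l2) : 0 <= sumsq f.
Proof. by apply: le_trans (sumsq_ge 0 (l2_bounded f)); rewrite big_geq. Qed.

Lemma l2dotPl a (f g h : l2) : l2dot (a *: f + g) h = a * l2dot f h + l2dot g h.
Proof. by rewrite l2_linE l2dotP//; exact: l2_bounded. Qed.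

Lemma l2dot_conj (f g : l2) : l2dot g f = Num.conj (l2dot f g).
Proof. by apply: l2dotC; exact: l2_bounded. Qed.

Lemma l2dot_ge0 (f : l2) : 0 <= l2dot f f.
Proof. by rewrite l2dotxx ?lecR ?sumsq_ge0//; exact: l2_bounded. Qed.

Lemma l2norm_dot (f : l2) : l2norm f ^+ 2 = l2dot f f.
Proof.
by rewrite l2dotxx; [rewrite /l2norm -rmorphXn /= sqr_sqrtr// sumsq_ge0|exact: l2_bounded].
Qed.

Lemma l2norm_ge0 (f : l2) : 0 <= l2norm f.
Proof. by rewrite lecR sqrtr_ge0. Qed.

Lemma l2normD (f g : l2) : l2norm (f + g) <= l2norm f + l2norm g.
Proof.
rewrite -(@ler_pXn2r _ 2)// ?nnegrE ?addr_ge0 ?l2norm_ge0//.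
have cs := hform_CauchySchwarz l2dotPl l2dot_conj l2dot_ge0 f g.
have D1 := hformDl l2dotPl; have D2 := hformDr l2dotPl l2dot_conj.
rewrite sqrrD !l2norm_dot (D1 f g (f + g)) !D2 (l2dot_conj f g).
set z := l2dot f g; rewrite -!addrA lerD2l !addrA lerD2r.
have h : `|l2dot f g| <= l2norm f * l2norm g.
  rewrite -(@ler_pXn2r _ 2)// ?nnegrE ?mulr_ge0 ?l2norm_ge0//.
  by rewrite exprMn !l2norm_dot.
apply: le_trans (_ : 2 * `|z| <= _); last by rewrite -mulr2n -[leRHS]mulr_natl ler_pM2l.
have r : (z + Num.conj z) \is Num.real.
  by rewrite CrealE rmorphD /= conjCK addrC.
apply: le_trans (real_ler_norm r) _.
by rewrite mulr_natl mulr2n; apply: le_trans (ler_normD _ _) _; rewrite norm_conjC.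
Qed.

Lemma l2normZ a (f : l2) : l2norm (a *: f) = `|a| * l2norm f.
Proof.
apply/eqP; rewrite -(@eqrXn2 _ 2)// ?mulr_ge0 ?l2norm_ge0//.
rewrite exprMn !l2norm_dot (hformZl l2dotPl) (hformZr l2dotPl l2dot_conj).
by rewrite mulrA normCK.
Qed.

Lemma l2norm_eq0 (f : l2) : l2norm f = 0 -> f = 0.
Proof.
move=> h; have : l2dot f f = 0 by rewrite -l2norm_dot h expr0n.
rewrite l2dotxx; last exact: l2_bounded.
move=> /(@complexI R _ 0) s0; apply: l2_ext => n _; apply: nrm_eq0.
have := sumsq_ge n.+1 (l2_bounded f); rewrite s0 big_nat_recr//= => h1.
apply/eqP; rewrite -sqrf_eq0 eq_le sqr_ge0 andbT; apply: le_trans h1.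
by rewrite lerDr sumr_ge0// => i _; rewrite sqr_ge0.
Qed.

HB.instance Definition _ := Lmodule_isNormed.Build R[i] l2 l2normD l2normZ l2norm_eq0.

Lemma l2_nrm2 (f : l2) : nrm f ^+ 2 = sumsq f.
Proof.
by have -> : nrm f = Num.sqrt (sumsq f) by []; rewrite sqr_sqrtr// sumsq_ge0.
Qed.

Lemma l2_partial (f : l2) N : \sum_(0 <= n < N) nrm (f n) ^+ 2 <= nrm f ^+ 2.
Proof. by rewrite l2_nrm2; apply: sumsq_ge; exact: l2_bounded. Qed.

Lemma l2_nrm_le (f : l2) (B : R) : 0 <= B ->
  (forall N, \sum_(0 <= n < N) nrm (f n) ^+ 2 <= B ^+ 2) -> nrm f <= B.
Proof.
move=> B0 h; rewrite -(@ler_pXn2r _ 2)// ?nnegrE ?nrm_ge0//.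
by rewrite l2_nrm2; apply: sumsq_le => //; exact: l2_bounded.
Qed.

Lemma l2_coord_le (f : l2) n : nrm (f n) <= nrm f.
Proof.
rewrite -(@ler_pXn2r _ 2)// ?nnegrE ?nrm_ge0//.
apply: le_trans (l2_partial f n.+1); rewrite big_nat_recr//=.
by rewrite lerDr sumr_ge0// => i _; rewrite sqr_ge0.
Qed.

(** The limit is taken entry by entry. For close [f] and [g] every partial sum of
    [nrm (f n - g n) ^+ 2] is at most [e ^+ 2]; letting [g] run along the filter with the length of
    the sum fixed replaces [g] by the limit, which gives both its square-summability and the
    convergence in norm. *)
Lemma l2_complete (F : set_system l2) : ProperFilter F -> cauchy F -> cvg F.
Proof.
move=> FF /cauchy_ballP cF.
have ball_nrm (f g : l2) (e : R) : ball f e%:C g -> nrm (f - g) <= e.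
  by rewrite -ball_normE /= nrmE ltcR => /ltW.
have cF' (e : R) : 0 < e -> \forall f & g \near F, nrm (f - g) <= e.
  move=> e0; have := cF e%:C; rewrite ltcR => /(_ e0).
  move=> [[A B] /= [FA FB] h]; exists (A, B) => //= -[f g] /= fg.
  by apply: ball_nrm; apply: (h (f, g)).
have cvg_coord n : cvg ((fun f : l2 => f n) @ F).
  apply: cauchy_cvg; apply/cauchy_ballP => e /complex_gt0[e0 ->].
  have e20 : 0 < complex.Re e / 2 by rewrite divr_gt0.
  have [[A B] /= [FA FB] h] := cF' _ e20.
  exists ([set f n | f in A], [set f n | f in B]) => /=.
    by split; [apply: filterS FA|apply: filterS FB] => f Af; exists f.
  move=> [_ _] /= [[f Af <-] [g Bg <-]].
  rewrite -ball_normE /= nrmE ltcR -l2valB.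
  apply: le_lt_trans (l2_coord_le _ _) _.
  apply: le_lt_trans (h (f, g) _) _ => //.
  by rewrite ltr_pdivrMr// ltr_pMr// ltr1n.
pose l n : H := lim ((fun f : l2 => f n) @ F).
have hl n : (fun f : l2 => f n) @ F --> l n by exact: cvg_coord.
have l_supp n : ~~ S n -> l n = 0.
  move=> Sn; apply: (cvg_lim_eq (hl n)); rewrite (_ : (fun f : l2 => f n) = fun=> 0).
    exact: cvg_cst.
  by apply/funext => f; rewrite l2_supp.
have near_l (e : R) : 0 < e -> \forall f \near F, forall N,
    \sum_(0 <= n < N) nrm ((f : l2) n - l n) ^+ 2 <= e ^+ 2.
  move=> e0; have [[A B] /= [FA FB] h] := cF' _ e0.
  apply: filterS FA => f Af N; apply/ler_addgt0Pr => d d0.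
  have cvgN : (\sum_(0 <= n < N) nrm (f n - (g : l2) n) ^+ 2) @[g --> F] -->
      \sum_(0 <= n < N) nrm (f n - l n) ^+ 2.
    have cvg1 n : (nrm (f n - (g : l2) n) ^+ 2) @[g --> F] --> nrm (f n - l n) ^+ 2.
      under eq_fun do rewrite expr2; rewrite expr2.
      have c1 : nrm (f n - (g : l2) n) @[g --> F] --> nrm (f n - l n).
        apply/cvgrPdist_le => e' e'0; have /cvg_nrmP/(_ _ e'0) := hl n.
        apply: filterS => g hg; apply: le_trans hg.
        have t1 : nrm (f n - l n) <= nrm (f n - g n) + nrm (l n - g n).
          by rewrite [nrm (l n - _)]nrmB; apply: le_trans (nrmD _ _); rewrite addrA subrK.
        have t2 : nrm (f n - g n) <= nrm (f n - l n) + nrm (l n - g n).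
          by apply: le_trans (nrmD _ _); rewrite addrA subrK.
        by rewrite ler_norml; lra.
      exact: cvgM.
    elim: N => [|N IH].
      rewrite big_geq//; under eq_fun do rewrite big_geq//; exact: cvg_cst.
    rewrite big_nat_recr//=; under eq_fun do rewrite big_nat_recr//=.
    by apply: cvgD.
  have /cvgrPdist_le/(_ _ d0) near_d := cvgN.
  have [g [hd Bg]] := filter_ex (filterI near_d FB).
  have : \sum_(0 <= n < N) nrm (f n - g n) ^+ 2 <= e ^+ 2.
    apply: le_trans (l2_partial (f - g) N) _.
    have fg : nrm (f - g) <= e by apply: (h (f, g)); split.
    by rewrite ler_pXn2r// nnegrE ?nrm_ge0// ltW.
  by move: hd; rewrite ler_norml; lra.
have l_in : l \in l2pred.
  apply/asboolP; split=> //.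
  have [f hf] := filter_ex (near_l 1 ltr01).
  have hfl : l2bounded ((f : nat -> H) - l) by exists (1 ^+ 2).
  have -> : l = (-1 : R[i]) *: ((f : nat -> H) - l) + f.
    by rewrite scaleN1r opprB subrK.
  by apply: l2boundedP => //; exact: l2_bounded.
apply/cvg_ex; exists (L2 l_in); apply/(@cvg_nrmP R l2 _ F _ id) => e e0.
apply: filterS (near_l e e0) => f hf; rewrite nrmB.
by apply: l2_nrm_le => [|N]; [exact: ltW|exact: hf].
Qed.

HB.instance Definition _ := Uniform_isComplete.Build l2 l2_complete.
HB.instance Definition _ := hasInnerProduct.Build R l2 l2dotPl l2dot_conj l2norm_dot.

End L2Space.
Arguments l2val {R S H} _ _ : simpl never.

(** * Single-entry sequences and amplified operators *)

Section L2Operators.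
Context {R : realType} (S : pred nat) (H : hilbertType R).
Local Notation L := (l2 S H).
Implicit Types (f g : L) (x y : H -> H).

Lemma l2_dotE f g : dot f g = limn (series (fun n => (dot (f n) (g n) : R[i]^o))).
Proof. by []. Qed.

Lemma cvg_l2_dot f g :
  (series (fun n => (dot (f n) (g n) : R[i]^o)) n : R[i]^o) @[n --> \oo]
    --> (dot f g : R[i]^o).
Proof. by apply: cvg_l2dot; exact: l2_bounded. Qed.

(** For [n] outside [S] and [a] nonzero this sequence is not in the space, and [insubd] returns 0;
    hence the condition [S n] in the lemmas on [delta]. *)
Definition delta n (a : H) : L := insubd 0 (fun m => if m == n then a else 0).

Lemma deltaE n a m : S n -> delta n a m = if m == n then a else 0.
Proof.
move=> Sn; have h : (fun m => if m == n then a else 0) \in l2pred S (H := H).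
  apply/asboolP; split=> [k Sk|]; first by case: eqP => // kn; rewrite kn Sn in Sk.
  exists (nrm a ^+ 2) => N; have [nN|Nn] := ltnP n N.
    rewrite (bigD1_seq n) ?mem_index_iota ?iota_uniq//= eqxx big1 ?addr0//.
    by move=> k /negbTE->; rewrite nrm0 expr0n.
  rewrite big_nat big1 ?sqr_ge0// => k /= kN; case: eqP => [kn|_].
    by move: kN; rewrite kn ltnNge Nn.
  by rewrite nrm0 expr0n.
by rewrite -[delta n a m]/(l2val (delta n a) m) -[l2val _]/(val _) val_insubd h.
Qed.

Lemma delta_diag n a : S n -> delta n a n = a.
Proof. by move=> Sn; rewrite deltaE// eqxx. Qed.

Lemma dot_delta f n a : S n -> dot f (delta n a) = dot (f n) a.
Proof.
move=> Sn; apply: (cvg_lim_eq (V := R[i]^o) (@cvg_l2_dot f (delta n a))).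
apply: cvg_near_cst; near=> N; rewrite /series /=.
have nN : (n < N)%N by near: N; exact: nbhs_infty_gt.
rewrite (bigD1_seq n) ?mem_index_iota ?iota_uniq//= delta_diag// big1 ?addr0//.
by move=> k /negbTE kn; rewrite deltaE// kn dot0r.
Unshelve. all: by end_near. Qed.

Definition trunc f N : L := \sum_(0 <= n < N | S n) delta n (f n).

Lemma truncE f N n : trunc f N n = if (n < N)%N then f n else 0.
Proof.
have [Sn|Sn] := boolP (S n); last by rewrite !l2_supp//; case: ifP.
rewrite /trunc l2val_sum; have [nN|Nn] := ltnP n N.
  rewrite big_mkcond (bigD1_seq n) ?mem_index_iota ?iota_uniq//= Sn delta_diag//.
  rewrite big1 ?addr0// => k kn; case: ifP => // Sk.
  by rewrite deltaE// eq_sym (negbTE kn).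
rewrite big_nat_cond big1// => k /= /andP[kN Sk]; rewrite deltaE//; case: eqP => // nk.
by move: kN; rewrite -nk ltnNge Nn.
Qed.

Lemma cvg_trunc f : trunc f N @[N --> \oo] --> f.
Proof.
apply/cvg_nrmP => e e0.
have /cvgrPdist_le h := cvg_sumsq (l2_bounded f).
have e20 : 0 < e ^+ 2 by rewrite exprn_gt0.
apply: filterS (h _ e20) => N hN; apply: l2_nrm_le => [|M]; first exact: ltW.
apply: le_trans hN; rewrite ger0_norm; last first.
  by rewrite subr_ge0; apply: sumsq_ge; exact: l2_bounded.
rewrite lerBrDl; apply: le_trans (sumsq_ge (maxn N M) (l2_bounded f)).
rewrite (@big_cat_nat _ _ _ N 0 (maxn N M))//= ?leq_maxl//; apply: lerD => //.
have [MN|/ltnW NM] := leqP M N.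
  rewrite big_nat big1 ?sumr_ge0// => [i _|i iM]; first exact: sqr_ge0.
  by rewrite l2valB truncE (leq_trans iM MN) subrr nrm0 expr0n.
rewrite (@big_cat_nat _ _ _ N 0 M)//= big_nat big1 ?add0r.
  rewrite !big_nat; apply: ler_sum => i /andP[Ni _].
  by rewrite l2valB truncE ltnNge Ni subr0.
by move=> i /= iN; rewrite l2valB truncE iN subrr nrm0 expr0n.
Qed.

Lemma lin_span_sum {V : lmodType R[i]} (A : set V) (J : Type) (s : seq J) (P : pred J) (F : J -> V) :
  (forall j, P j -> A (F j)) -> lin_span A (\sum_(j <- s | P j) F j).
Proof.
move=> h; rewrite -big_filter; have := seq.filter_all P s; move: (seq.filter P s) => {}s.
case: s => [_|j0 s /(all_nthP j0) hs].
  exists 0%N, (fun=> 0), (fun=> 0); split; first by case.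
  by rewrite big_nil big_ord0.
exists (size (j0 :: s)), (fun=> 1), (fun k => F (nth j0 (j0 :: s) k)); split.
  by move=> k; apply: h; exact: hs.
by rewrite (big_nth j0) big_mkord; apply: eq_bigr => k _; rewrite scale1r.
Qed.

Lemma delta_span_dense : closure (lin_span [set delta n a | n in [set n | S n] & a in setT]) = setT.
Proof.
apply/seteqP; split=> // f _; apply/closure_nrmP => e e0.
have /cvg_nrmP/(_ _ e0)/filter_ex[N hN] := @cvg_trunc f.
by exists (trunc f N) => //; apply: lin_span_sum => n Sn; exists n => //; exists (f n).
Qed.

Lemma delta_bounded n : bounded (delta n : H -> L).
Proof.
have [Sn|Sn] := boolP (S n); last first.
  rewrite (_ : delta n = fun=> 0); first exact: bounded0.
  apply/funext => a; rewrite /delta /insubd; case: insubP => //= f _ fE.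
  apply/val_inj/funext => m /=; have [->|mn] := eqVneq m n; first by rewrite l2_supp.
  by rewrite fE (negbTE mn).
split=> [a u v|].
  by apply: l2_ext => m _; rewrite l2valD l2valZ !deltaE//; case: eqP; rewrite // scaler0 addr0.
exists 1 => // a; rewrite mul1r; apply: l2_nrm_le => [|N]; first exact: nrm_ge0.
have [nN|Nn] := ltnP n N.
  rewrite (bigD1_seq n) ?mem_index_iota ?iota_uniq//= delta_diag// big1 ?addr0//.
  by move=> k /negbTE kn; rewrite deltaE// kn nrm0 expr0n.
rewrite big_nat big1 ?sqr_ge0// => k /= kN; rewrite deltaE//; case: eqP => [kn|_].
  by move: kN; rewrite kn ltnNge Nn.
by rewrite nrm0 expr0n.
Qed.

Lemma l2_eq_delta (V : normedModType R[i]) (A : set H) (T U : L -> V) :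
  bounded T -> bounded U -> determining A ->
  (forall n a, S n -> A a -> T (delta n a) = U (delta n a)) -> T = U.
Proof.
move=> bT bU hA h; apply: (bounded_eqT bT bU delta_span_dense).
move=> _ [n Sn [a _ <-]].
have bd := delta_bounded n.
by have := hA _ _ _ (bounded_comp bT bd) (bounded_comp bU bd) (fun a => h n a Sn) => /(congr1 (@^~ a)).
Qed.

(** The direct sum of copies of [x]. With support [S] it is the GNS representation, with [predT] it
    expresses the functionals that define the sigma-weak topology. The default 0 is avoided as soon
    as [x] is bounded. *)
Definition amp x f : L := insubd 0 (fun n => x (f n)).

Lemma ampE x f n : bounded x -> amp x f n = x (f n).
Proof.
move=> [lx [C C0 hC]]; have h : (fun n => x (f n)) \in l2pred S (H := H).
  apply/asboolP; split=> [k Sk|]; first by rewrite l2_supp// lin0.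
  exists (C ^+ 2 * nrm f ^+ 2) => N.
  apply: (le_trans _ (ler_wpM2l (sqr_ge0 C) (l2_partial f N))).
  rewrite mulr_sumr; apply: ler_sum => k _; rewrite -exprMn.
  by rewrite ler_pXn2r// nnegrE ?nrm_ge0// mulr_ge0// nrm_ge0.
by rewrite -[amp x f n]/(l2val (amp x f) n) -[l2val _]/(val _) val_insubd h.
Qed.

Lemma amp_nrm_le x C f : linear x -> 0 <= C -> (forall u, nrm (x u) <= C * nrm u) ->
  nrm (amp x f) <= C * nrm f.
Proof.
move=> lx C0 hC; have bx : bounded x by split=> //; exists C.
apply: l2_nrm_le => [|N]; first by rewrite mulr_ge0// nrm_ge0.
rewrite exprMn; apply: (le_trans _ (ler_wpM2l (sqr_ge0 C) (l2_partial f N))).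
rewrite mulr_sumr; apply: ler_sum => k _; rewrite -exprMn ampE//.
by rewrite ler_pXn2r// nnegrE ?nrm_ge0// mulr_ge0// nrm_ge0.
Qed.

Lemma amp_bounded x : bounded x -> bounded (amp x).
Proof.
move=> bx; have [lx [C C0 hC]] := bx; split=> [a f g|].
  by apply: l2_ext => n _; rewrite l2valD l2valZ !ampE// l2valD l2valZ lx.
by exists C => // f; exact: amp_nrm_le.
Qed.

Lemma amp_linear (a : R[i]) x y : bounded x -> bounded y ->
  amp (a *: x + y) = a *: amp x + amp y.
Proof.
move=> bx by_; apply/funext => f; apply: l2_ext => n _.
rewrite ampE; last exact: boundedP.
by rewrite [RHS]/= l2valD l2valZ !ampE.
Qed.

Lemma amp_id : amp id = id.
Proof. by apply/funext => f; apply: l2_ext => n _; rewrite ampE//; exact: bounded_id. Qed.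

Lemma amp_comp x y : bounded x -> bounded y -> amp (x \o y) = amp x \o amp y.
Proof.
move=> bx by_; apply/funext => f; apply: l2_ext => n _.
by rewrite ampE /= ?ampE//; exact: bounded_comp.
Qed.

Lemma amp_delta x n a : bounded x -> S n -> amp x (delta n a) = delta n (x a).
Proof.
move=> bx Sn; apply: l2_ext => m _; rewrite ampE// !deltaE//.
by case: eqP => // _; rewrite lin0//; exact: bounded_lin.
Qed.

Lemma amp_adjoint x y : bounded x -> bounded y -> adjoint x y ->
  adjoint (amp x) (amp y).
Proof.
move=> bx by_ h f g; rewrite !l2_dotE; 
have -> // : (fun n => (dot (amp x f n) (g n) : R[i]^o)) = fun n => dot (f n) (amp y g n).
by apply/funext => n; rewrite !ampE//; exact: h.
Qed.

Lemma amp_positive x : bounded x -> positive x -> positive (amp x).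
Proof.
move=> bx px f; apply: (cvg_ge0 (@cvg_l2_dot (amp x f) f)); near=> N.
by rewrite /series /= sumr_ge0// => n _; rewrite ampE.
Unshelve. all: by end_near. Qed.

End L2Operators.
Arguments delta {R S H} n a.
Arguments amp {R S H} x f.

(** * Orthonormal sequences *)

Section OrthonormalSequences.
Context {R : realType} {H : hilbertType R}.
Implicit Types (c d e : nat -> H) (u v : H).

(* zero entries are allowed, so that finite orthonormal families are covered *)
Definition onseq c : Prop :=
  (forall n m, n != m -> dot (c n) (c m) = 0) /\
  (forall n, c n = 0 \/ dot (c n) (c n) = 1).

Definition pairseq c d : Prop :=
  [/\ onseq c, onseq d & forall n, c n = 0 <-> d n = 0].

(** By Pythagoras the squared distance of two partial sums is a section of the convergent series of
    squared norms, so the partial sums are Cauchy. *)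
Lemma orth_series (w : nat -> H) (B : R) : 0 <= B ->
  (forall n m, n != m -> dot (w n) (w m) = 0) ->
  (forall N, \sum_(0 <= n < N) nrm (w n) ^+ 2 <= B ^+ 2) ->
  series w n @[n --> \oo] --> limn (series w) /\ nrm (limn (series w)) <= B.
Proof.
move=> B0 ow hB.
have lw : l2bounded w by exists (B ^+ 2).
have diff N n : (N <= n)%N ->
    nrm (series w N - series w n) ^+ 2 = \sum_(N <= k < n) nrm (w k) ^+ 2.
  move=> Nn; rewrite nrmB /series /= (@big_cat_nat _ _ _ N 0 n)//= addrAC subrr add0r.
  rewrite pythagoras_sum ?iota_uniq// => i j _ _; exact: ow.
have cw : series w n @[n --> \oo] --> limn (series w).
  apply: cauchy_cvg; apply: cauchy_exP => eps /complex_gt0[e0 ->].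
  set e := complex.Re eps in e0 *.
  have e20 : 0 < (e / 2) ^+ 2 by rewrite exprn_gt0// divr_gt0.
  have /cvgrPdist_le/(_ _ e20) [N _ hN] := cvg_sumsq lw.
  exists (series w N); exists N => // n /= Nn.
  rewrite -ball_normE /= nrmE ltcR.
  apply: (@le_lt_trans _ _ (e / 2)); last by rewrite ltr_pdivrMr// ltr_pMr// ltr1n.
  rewrite -(@ler_pXn2r _ 2)// ?nnegrE ?nrm_ge0// ?divr_ge0 ?(ltW e0)// diff//.
  have := hN N (leqnn N); rewrite ger0_norm ?subr_ge0 ?sumsq_ge//.
  apply: le_trans; rewrite lerBrDl /series /= -big_cat_nat//.
  exact: sumsq_ge.
split=> //; apply: (cvg_nrm_le cw); near=> n.
rewrite -(@ler_pXn2r _ 2)// ?nnegrE ?nrm_ge0// /series /= pythagoras_sum ?iota_uniq//.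
by move=> i j _ _; exact: ow.
Unshelve. all: by end_near. Qed.

Lemma onseq_nrm c n : onseq c -> c n = 0 \/ nrm (c n) = 1.
Proof.
move=> [_ /(_ n)[->|h]]; [by left|right].
move: h; rewrite dotxx => /(@complexI R _ 1) h.
by apply/eqP; rewrite -(@eqrXn2 _ 2) ?nrm_ge0// expr1n h.
Qed.

Lemma pairseq_refl c : onseq c -> pairseq c c. Proof. by []. Qed.

Lemma pairseq_sym c d : pairseq c d -> pairseq d c.
Proof. by move=> [h1 h2 h3]; split=> // n; split=> /h3. Qed.

Lemma pairseq_trans c d e : pairseq c d -> pairseq d e -> pairseq c e.
Proof. by move=> [h1 h2 h3] [h4 h5 h6]; split=> // n; split=> [/h3/h6|/h6/h3]. Qed.

Lemma pairseq_nrm c d n : pairseq c d -> nrm (c n) = nrm (d n).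
Proof.
move=> [hc hd h]; case: (onseq_nrm n hc) => [c0|c1].
  by rewrite c0; have /h -> := c0; rewrite !nrm0.
case: (onseq_nrm n hd) => [d0|d1]; last by rewrite c1 d1.
by move: c1; have /h -> := d0; rewrite nrm0 => /eqP; rewrite eq_sym oner_eq0.
Qed.

Lemma onseq_coef c u n : onseq c -> dot u (c n) * dot (c n) (c n) = dot u (c n).
Proof. by move=> [_ /(_ n)[->|->]]; rewrite ?mulr1// dot0r mul0r. Qed.

Lemma onseq_residual c u N k : onseq c -> (k < N)%N ->
  dot (u - \sum_(0 <= n < N) dot u (c n) *: c n) (c k) = 0.
Proof.
move=> hc kN; rewrite dotBl dot_suml (bigD1_seq k) ?mem_index_iota ?iota_uniq//=.
rewrite dotZl onseq_coef// big1 ?addr0 ?subrr// => j jk.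
by rewrite dotZl hc.1// mulr0.
Qed.

Lemma Bessel c u N : onseq c ->
  \sum_(0 <= n < N) nrm (dot u (c n) *: c n) ^+ 2 <= nrm u ^+ 2.
Proof.
move=> hc; rewrite -pythagoras_sum ?iota_uniq//; last first.
  by move=> i j _ _ ij; rewrite dotZl dotZr hc.1// !mulr0.
set s := \sum_(_ <= _ < _) _.
have h : dot (u - s) s = 0.
  rewrite {2}/s dot_sumr big_nat big1// => k /andP[_ kN].
  by rewrite dotZr onseq_residual// mulr0.
by rewrite -{1}(subrK s u) pythagoras// lerDr sqr_ge0.
Qed.

(** For a pair as in [pairseq] this is the partial isometry that sends [c n] to [d n], from the
    closed span of [c] onto that of [d]. With [d = c] it is the orthogonal projection onto the
    closed span of [c]. *)
Definition partial_isom c d u : H := limn (series (fun n => dot u (c n) *: d n)).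
Local Notation V := partial_isom.

Lemma partial_isom_cvg_nrm c d u : pairseq c d ->
  series (fun n => dot u (c n) *: d n) n @[n --> \oo] --> V c d u /\ nrm (V c d u) <= nrm u.
Proof.
move=> hcd; apply: orth_series => [|n m nm|N]; first exact: nrm_ge0.
  by have [_ [h _] _] := hcd; rewrite dotZl dotZr h// !mulr0.
have [hc _ _] := hcd; apply: (le_trans _ (Bessel u N hc)).
by apply: ler_sum => n _; rewrite !nrmZ (pairseq_nrm _ hcd).
Qed.

Lemma partial_isom_cvg c d u : pairseq c d ->
  series (fun n => dot u (c n) *: d n) n @[n --> \oo] --> V c d u.
Proof. by move=> /(partial_isom_cvg_nrm u)[]. Qed.
Arguments partial_isom_cvg {c d} u _ t _.

Lemma partial_isom_nrm c d u : pairseq c d -> nrm (V c d u) <= nrm u.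
Proof. by move=> /(partial_isom_cvg_nrm u)[]. Qed.

Lemma partial_isom_bounded c d : pairseq c d -> bounded (V c d).
Proof.
move=> hcd; split=> [a u v|].
  apply: (cvg_lim_eq (partial_isom_cvg _ hcd)).
  apply: (eq_cvg_fun _ (cvgD (cvg_scale a (partial_isom_cvg u hcd)) (partial_isom_cvg v hcd))) => n.
  rewrite /series /= scaler_sumr -big_split /=; apply: eq_bigr => k _.
  by rewrite dotPl scalerDl scalerA.
by exists 1 => // u; rewrite mul1r; exact: partial_isom_nrm.
Qed.

Lemma partial_isom_basis c d n : pairseq c d -> V c d (c n) = d n.
Proof.
move=> hcd; apply: (cvg_lim_eq (partial_isom_cvg _ hcd)).
apply: cvg_near_cst; near=> N; rewrite /series /=.
have nN : (n < N)%N by near: N; exact: nbhs_infty_gt.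
have [hc hd h0] := hcd.
rewrite (bigD1_seq n) ?mem_index_iota ?iota_uniq//= big1 ?addr0; last first.
  by move=> k kn; rewrite hc.1 ?scale0r// eq_sym.
by case: (hc.2 n) => [c0|->]; rewrite ?scale1r// (h0 n).1// scaler0.
Unshelve. all: by end_near. Qed.

Lemma partial_isom_comp c d e u : pairseq c d -> pairseq d e ->
  V d e (V c d u) = V c e u.
Proof.
move=> hcd hde; have hce := pairseq_trans hcd hde.
apply: (cvg_lim_eq _ (partial_isom_cvg u hce)).
apply: cvg_trans (bounded_cvg (partial_isom_bounded hde) (partial_isom_cvg u hcd)).
apply: near_eq_cvg; near=> n; rewrite /series /=.
have le := bounded_lin (partial_isom_bounded hde).
by rewrite lin_sum//; apply: eq_bigr => k _; rewrite linZ// partial_isom_basis.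
Unshelve. all: by end_near. Qed.

Lemma partial_isom_closed c d u (K : set H) : pairseq c d -> closed_subspace K ->
  (forall n, K (d n)) -> K (V c d u).
Proof.
move=> hcd [K0 KP Kc] Kd; apply: (closed_cvg _ Kc _ _ (partial_isom_cvg u hcd)).
near=> n; rewrite /series /=; elim/big_ind: _ => // [x y Kx Ky|k _].
  by rewrite -[x]scale1r; exact: KP.
by rewrite -[_ *: _]addr0; exact: KP.
Unshelve. all: by end_near. Qed.

Lemma partial_isom_residual c u n : onseq c -> dot (u - V c c u) (c n) = 0.
Proof.
move=> hc; apply: (cvg_lim_eq (V := R[i]^o) (F := \oo)); last exact: (cvg_cst (0 : R[i]^o)).
apply: cvg_trans (cvg_dotl (y := c n) (cvgB (cvg_cst u) (partial_isom_cvg u (pairseq_refl hc)))).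
apply: near_eq_cvg; near=> N => /=.
rewrite onseq_residual//; near: N; exact: nbhs_infty_gt.
Unshelve. all: by end_near. Qed.

Lemma partial_isom_residual_dot c u v : onseq c -> dot (u - V c c u) (V c c v) = 0.
Proof.
move=> hc; apply: (cvg_lim_eq (V := R[i]^o) (F := \oo)); last exact: (cvg_cst (0 : R[i]^o)).
apply: cvg_trans (cvg_dotr (y := u - V c c u) (partial_isom_cvg v (pairseq_refl hc))).
apply: near_eq_cvg; near=> N => /=.
rewrite /series /= dot_sumr big1// => k _.
by rewrite dotZr partial_isom_residual// mulr0.
Unshelve. all: by end_near. Qed.

Lemma partial_isom_adjoint c : onseq c -> adjoint (V c c) (V c c).
Proof.
move=> hc u v; have h1 := partial_isom_residual_dot u v hc.
have h2 := dot_sym0 (partial_isom_residual_dot v u hc).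
move: h1 h2; rewrite dotBl dotBr => /eqP; rewrite subr_eq0 => /eqP->.
by move=> /eqP; rewrite subr_eq0 => /eqP.
Qed.

Lemma orthoprojP (K : set H) u p : K p -> (forall z, K z -> dot (u - p) z = 0) ->
  orthoproj K u = p.
Proof.
move=> Kp hp; rewrite /orthoproj; case: xgetP => [q _ [Kq hq]|/(_ p)/(_ (conj Kp hp))//].
apply/eqP; rewrite -subr_eq0; apply/eqP/dotxx_eq0.
have h z : K z -> dot (q - p) z = 0.
  move=> Kz; have -> : q - p = (u - p) - (u - q) by rewrite opprB [RHS]addrC addrA subrK.
  by rewrite dotBl hp// hq// subrr.
by rewrite dotBr !h// subrr.
Qed.

Lemma orthoproj_onseq (K B : set H) c : closed_subspace K -> orthonormal_basis K B ->
  onseq c -> (forall n, c n = 0 \/ B (c n)) -> (forall b, B b -> exists n, c n = b) ->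
  orthoproj K = V c c.
Proof.
move=> Ksub [BK B1 B2 BKc] hc cB Bc; apply/funext => u; apply: orthoprojP.
  apply: partial_isom_closed => // n; case: (cB n) => [->|/BK//]; by case: Ksub.
move=> z Kz.
have h : forall b, B b -> dot b (u - V c c u) = 0.
  by move=> b /Bc[n <-]; apply: dot_sym0; exact: partial_isom_residual.
apply: dot_sym0.
apply: (@bounded_eq R H R[i]^o B (fun z => dot z (u - V c c u)) (fun=> 0)) => //.
- by apply: (@bounded_dotl R H H id); exact: bounded_id.
- exact: bounded0.
- by rewrite BKc.
Qed.

(** The adjoint is the explicit series of the [dot v (x (c n)) *: c n]. A partial sum [s] satisfies
    [dot s s = dot v (x s)], hence [nrm s <= C * nrm v], and [orth_series] applies. *)
Lemma adjoint_exists c (x : H -> H) : onseq c -> determining (range c) ->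
  bounded x -> exists2 y, bounded y & adjoint x y.
Proof.
move=> hc dc bx; have [lx [C C0 hC]] := bx.
have key v : let w n := dot v (x (c n)) *: c n in
    series w n @[n --> \oo] --> limn (series w) /\ nrm (limn (series w)) <= C * nrm v.
  move=> w; apply: orth_series => [|n m nm|N]; first by rewrite mulr_ge0// nrm_ge0.
    by rewrite dotZl dotZr hc.1// !mulr0.
  have ow i j : i != j -> dot (w i) (w j) = 0.
    by move=> ij; rewrite dotZl dotZr hc.1// !mulr0.
  rewrite -pythagoras_sum ?iota_uniq//; last by move=> i j _ _; exact: ow.
  set s := \sum_(_ <= _ < _) _.
  have e : dot s s = dot v (x s).
    rewrite /s dot_suml lin_sum// dot_sumr; apply: eq_big_nat => k /andP[_ kN].
    rewrite linZ// dotZr dot_sumr (bigD1_seq k) ?mem_index_iota ?iota_uniq//= big1 ?addr0.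
      rewrite dotZl dotZr; case: (hc.2 k) => [->|->].
        by rewrite lin0// !dot0r !mulr0.
      by rewrite mulr1 mulrC.
    by move=> j jk; rewrite ow// eq_sym.
  have h : nrm s ^+ 2 <= C * nrm v * nrm s.
    have e1 : nrm s ^+ 2 = nrm (dot v (x s) : R[i]^o).
      by rewrite -e dotxx nrm_real ger0_norm// sqr_ge0.
    rewrite e1; apply: le_trans (dot_CauchySchwarz _ _) _.
    by rewrite -mulrA mulrCA ler_wpM2l ?nrm_ge0.
  rewrite ler_pXn2r// ?nnegrE ?nrm_ge0// ?mulr_ge0 ?nrm_ge0//.
  have := nrm_ge0 s; rewrite le_eqVlt => /orP[/eqP<-|s0].
    by rewrite mulr_ge0// nrm_ge0.
  by move: h; rewrite expr2 ler_pM2r.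
pose y v := limn (series (fun n => dot v (x (c n)) *: c n)).
have xy : adjoint x y.
  move=> u v.
  have b1 := bounded_dotl v bx.
  have b2 := bounded_dotl (y v) (@bounded_id R H).
  suff e : (fun u => dot (x u) v : R[i]^o) = (fun u => dot u (y v) : R[i]^o).
    exact: (congr1 (@^~ u) e).
  apply: (dc _ _ _ b1 b2) => _ [m _ <-] /=.
  apply: (cvg_lim_eq (V := R[i]^o) (F := \oo)); last exact: cvg_dotr (key v).1.
  apply: cvg_near_cst; near=> N; rewrite /series /=.
  have nN : (m < N)%N by near: N; exact: nbhs_infty_gt.
  rewrite dot_sumr (bigD1_seq m) ?mem_index_iota ?iota_uniq//= big1 ?addr0; last first.
    by move=> k kn; rewrite dotZr hc.1 ?mulr0// eq_sym.
  rewrite dotZr -dotC; case: (hc.2 m) => [->|->]; last by rewrite mulr1.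
  by rewrite lin0// !dot0l mul0r.
exists y => //; split; last by exists C => // v; exact: (key v).2.
move=> a u v; apply/eqP; rewrite -subr_eq0; apply/eqP/dotxx_eq0.
set z := _ - _; rewrite {2}/z dotBr dotDr dotZr -!xy dotDr dotZr subrr//.
Unshelve. all: by end_near. Qed.

End OrthonormalSequences.
Arguments partial_isom {R H} c d u.

(** * Enumeration of orthonormal bases in a separable space *)

Section Enumeration.
Context {R : realType} {H : hilbertType R}.
Hypothesis sepH : separable H.

(** Distinct members are at distance the square root of 2, so choosing a point of the countable
    dense set within 1/2 of each member is injective. *)
Lemma orthonormal_countable (B : set H) :
  (forall x, B x -> dot x x = 1) ->
  (forall x y, B x -> B y -> x <> y -> dot x y = 0) -> countable B.
Proof.
move=> B1 B2; have [D [cD dD]] := sepH.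
have near_D b : exists d, D d /\ nrm (b - d) < 1 / 2.
  have e0 : (0 : R[i]) < (1 / 2)%:C by rewrite ltcR divr_gt0.
  have [] := dD (ball b (1 / 2)%:C)^°.
  - exists b; apply: nbhs_singleton; apply: nbhs_interior; exact: nbhsx_ballx.
  - exact: open_interior.
  move=> d [/interior_subset bd Dd]; exists d; split=> //.
  by move: bd; rewrite -ball_normE /= nrmE ltcR.
have [g hg] := choice near_D.
have /countable_injP[f fi] := cD.
apply/countable_injP; exists (f \o g) => a b /set_mem Ba /set_mem Bb /= /fi.
rewrite !inE => /(_ (hg a).1 (hg b).1) gab.
apply: contrapT => ab.
have e : nrm (a - b) ^+ 2 = 2.
  apply: complexI; rewrite -dotxx dotBl !dotBr !B1// (B2 a b)// (B2 b a)//; last by move=> h; exact: ab.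
  by rewrite subr0 sub0r opprK rmorph_nat.
have h : nrm (a - b) <= 1.
  have -> : a - b = (a - g a) - (b - g b) by rewrite gab opprB addrA subrK.
  apply: le_trans (nrmD _ _) _; rewrite nrmN.
  by have := (hg a).2; have := (hg b).2; lra.
have : nrm (a - b) ^+ 2 <= 1 by rewrite expr_le1// nrm_ge0.
by rewrite e; lra.
Qed.

Lemma orthonormal_enum (B : set H) :
  (forall x, B x -> dot x x = 1) ->
  (forall x y, B x -> B y -> x <> y -> dot x y = 0) ->
  exists c, [/\ onseq c, forall n, c n = 0 \/ B (c n),
                (forall b, B b -> exists n, c n = b) &
                forall n m, c n <> 0 -> c n = c m -> n = m].
Proof.
move=> B1 B2; have /countable_injP[f fi] := orthonormal_countable B1 B2.
pose c n := if pselect (exists2 b, B b & f b = n) is left p then projT1 (cid2 p) else 0.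
have cP n : c n = 0 \/ (B (c n) /\ f (c n) = n).
  rewrite /c; case: pselect => [p|_]; last by left.
  by right; case: cid2 => b Bb fb.
have cB b : B b -> c (f b) = b.
  move=> Bb; rewrite /c; case: pselect => [p|]; last by case; exists b.
  by case: cid2 => b' Bb' /= fb; apply: fi => //; rewrite inE.
have inj n m : c n <> 0 -> c n = c m -> n = m.
  move=> n0 nm; case: (cP n) => [//|[_ <-]]; case: (cP m) => [m0|[_ <-]].
    by move: n0; rewrite nm m0.
  by rewrite nm.
exists c; split=> //.
- split=> [n m nm|n]; last by case: (cP n) => [|[/B1]]; [left|right].
  case: (cP n) => [->|[Bn _]]; first by rewrite dot0l.
  case: (cP m) => [->|[Bm _]]; first by rewrite dot0r.
  apply: B2 => // cnm; move/eqP: nm; apply; apply: inj => // n0.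
  by move: (B1 _ Bn); rewrite n0 dot0l => /eqP; rewrite eq_sym oner_eq0.
- by move=> n; case: (cP n) => [|[]]; [left|right].
- by move=> b /cB; exists (f b).
Qed.

Lemma same_dim_pairseq (K L : set H) : same_dim K L -> exists B C c d,
  [/\ orthonormal_basis K B, orthonormal_basis L C, pairseq c d,
      (forall n, c n = 0 \/ B (c n)) /\ (forall b, B b -> exists n, c n = b) &
      (forall n, d n = 0 \/ C (d n)) /\ (forall b, C b -> exists n, d n = b)].
Proof.
move=> [B [C [hB hC /card_set_bijP[f [fBC fi fs]]]]]; exists B, C.
have [BK B1 B2 _] := hB; have [CL C1 C2 _] := hC.
have [c [hc cB Bc ci]] := orthonormal_enum B1 B2.
have B0 : ~ B 0 by move=> /B1/eqP; rewrite dot0l eq_sym oner_eq0.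
have C0 : ~ C 0 by move=> /C1/eqP; rewrite dot0l eq_sym oner_eq0.
(* The bijection [f] is only controlled on [B], which does not contain 0, so the zeros of [c] are
   carried over separately. *)
pose d n := if pselect (c n = 0) is left _ then 0 else f (c n).
have dP n : (c n = 0 /\ d n = 0) \/ [/\ B (c n), C (d n) & d n = f (c n)].
  rewrite /d; case: pselect => [->|c0]; [by left|right].
  by case: (cB n) => // Bn; split=> //; exact: fBC.
exists c, d; split=> //; last first.
  split=> [n|b /fs[a Ba <-]].
    by case: (dP n) => [[]|[]]; [left|right].
  have [n cn] := Bc a Ba; exists n; case: (dP n) => [[c0]|[_ _ ->]]; last by rewrite cn.
  by exfalso; apply: B0; rewrite -c0 cn.
split=> //; last first.
  move=> n; case: (dP n) => [[-> ->]//|[Bn Cn _]].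
  by split=> h; exfalso; [apply: B0; rewrite -h|apply: C0; rewrite -h].
split=> [n m nm|n]; last by case: (dP n) => [[_]|[_ /C1]]; [left|right].
case: (dP n) => [[_ ->]|[Bn Cn en]]; first by rewrite dot0l.
case: (dP m) => [[_ ->]|[Bm Cm em]]; first by rewrite dot0r.
apply: C2 => // dnm; move/eqP: nm; apply; apply: ci.
  by move=> h; apply: B0; rewrite -h.
by apply: fi; rewrite ?inE// -en -em.
Qed.

End Enumeration.

(** * Block decompositions *)

Section Projections.
Context {R : realType} {H : hilbertType R}.

Lemma orthoproj_basisP (K B : set H) : separable H -> closed_subspace K ->
  orthonormal_basis K B ->
  [/\ bounded (orthoproj K), adjoint (orthoproj K) (orthoproj K),
      forall u, K (orthoproj K u) &
      forall u, K u -> orthoproj K u = u].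
Proof.
move=> sH hK hB; have [BK B1 B2 _] := hB.
have [c [hc cB Bc _]] := orthonormal_enum sH B1 B2.
have hcc := pairseq_refl hc.
rewrite (orthoproj_onseq hK hB hc cB Bc); split.
- exact: partial_isom_bounded.
- exact: partial_isom_adjoint.
- move=> u; apply: partial_isom_closed => // n.
  by case: (cB n) => [->|/BK//]; case: hK.
- move=> u Ku; rewrite -(orthoproj_onseq hK hB hc cB Bc); apply: orthoprojP => // z _.
  by rewrite subrr dot0l.
Qed.

End Projections.

Lemma ler_sum_subset {R : numDomainType} (J : eqType) (s t : seq J) (f : J -> R) :
  uniq s -> uniq t -> {subset s <= t} -> (forall j, 0 <= f j) ->
  \sum_(j <- s) f j <= \sum_(j <- t) f j.
Proof.
move=> us ut st f0; rewrite [leRHS](bigID [in s])/= -[X in _ <= X + _]big_filter.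
rewrite (perm_big (seq.filter [in s] t)) ?lerDl ?sumr_ge0//.
apply: uniq_perm; rewrite ?filter_uniq// => j; rewrite mem_filter.
by apply/idP/andP => [js|[]//]; split=> //; exact: st.
Qed.

#[local] Existing Instance summability.totally_filter.

Section Blocks.
Context {R : realType} {H : hilbertType R} {I : choiceType} (K : I -> set H).
Hypothesis sepH : separable H.
Hypothesis decK : orthogonal_decomposition K.
Hypothesis dimK : forall i j, same_dim (K i) (K j).

Local Notation p i := (orthoproj (K i)).

Lemma block_closed i : closed_subspace (K i). Proof. by case: decK. Qed.

Lemma block_orth i j u v : i <> j -> K i u -> K j v -> dot u v = 0.
Proof. by case: decK => _ h _; exact: h. Qed.

Lemma blocks_total : determining (\bigcup_i K i).
Proof. by case: decK => _ _ h V x y bx by_; exact: bounded_eqT. Qed.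

Lemma block_op_ext (V : normedModType R[i]) (x y : H -> V) : bounded x -> bounded y ->
  (forall i u, K i u -> x u = y u) -> x = y.
Proof. by move=> bx by_ h; apply: blocks_total => // u [i _ Ku]; exact: h Ku. Qed.

Lemma block_projP i : [/\ bounded (p i), adjoint (p i) (p i),
   forall u, K i (p i u) & forall u, K i u -> p i u = u].
Proof.
have [B [_ [hB _ _]]] := dimK i i.
exact: orthoproj_basisP sepH (block_closed i) hB.
Qed.

Lemma proj_bounded i : bounded (p i). Proof. by case: (block_projP i). Qed.
Lemma proj_lin i : linear (p i). Proof. exact: bounded_lin (proj_bounded i). Qed.
Lemma proj_adj i u v : dot (p i u) v = dot u (p i v).
Proof. by case: (block_projP i) => _ h _ _; exact: h. Qed.
Lemma proj_in i u : K i (p i u). Proof. by case: (block_projP i). Qed.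
Lemma proj_id i u : K i u -> p i u = u. Proof. by case: (block_projP i) => _ _ _; apply. Qed.

Lemma proj_block0 i j u : i <> j -> K j u -> p i u = 0.
Proof.
move=> ij Ku; apply: dotxx_eq0; rewrite proj_adj proj_id; last exact: proj_in.
by apply: dot_sym0; apply: block_orth ij _ Ku; exact: proj_in.
Qed.

Lemma proj_block i j u : K j u -> p i u = if i == j then u else 0.
Proof. by move=> Ku; case: eqP => [->|ij]; [exact: proj_id|exact: proj_block0 Ku]. Qed.

Lemma block0 i : K i 0. Proof. by case: (block_closed i). Qed.

Definition block_proj (F : seq I) u : H := \sum_(i <- F) p i u.

Lemma proj_orth i j u v : i != j -> dot (p i u) (p j v) = 0.
Proof. by move=> /eqP ij; apply: (block_orth ij); exact: proj_in. Qed.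

Lemma block_proj_residual F u : uniq F -> dot (u - block_proj F u) (block_proj F u) = 0.
Proof.
move=> uF; rewrite {2}/block_proj dot_sumr big_seq big1// => i iF.
rewrite dotBl dot_suml (bigD1_seq i)//= [X in _ - (_ + X)]big1 ?addr0; last first.
  by move=> j ji; rewrite proj_orth.
by rewrite [dot (p i u) _]proj_adj [p i (p i u)]proj_id ?subrr//; exact: proj_in.
Qed.

Lemma block_proj_nrm F u : uniq F -> nrm (block_proj F u) <= nrm u.
Proof.
move=> uF; rewrite -(@ler_pXn2r _ 2)// ?nnegrE ?nrm_ge0//.
by rewrite -[X in _ <= nrm X ^+ 2](subrK (block_proj F u)) pythagoras ?block_proj_residual// lerDr sqr_ge0.
Qed.

Lemma block_Bessel F u : uniq F -> \sum_(i <- F) nrm (p i u) ^+ 2 <= nrm u ^+ 2.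
Proof.
move=> uF; rewrite -pythagoras_sum//; last by move=> i j _ _; exact: proj_orth.
by rewrite ler_pXn2r// ?nnegrE ?nrm_ge0//; exact: block_proj_nrm.
Qed.

Lemma block_proj_bounded F : bounded (block_proj F).
Proof.
rewrite (_ : block_proj F = \sum_(i <- F) p i).
  by apply: bounded_sum => i; exact: proj_bounded.
by apply/funext => u; rewrite /block_proj fct_sumE.
Qed.

Lemma block_proj_adj F u v : dot (block_proj F u) v = dot u (block_proj F v).
Proof. by rewrite dot_suml dot_sumr; apply: eq_bigr => i _; exact: proj_adj. Qed.

Lemma block_proj_block F j u : uniq F -> K j u -> block_proj F u = if j \in F then u else 0.
Proof.
move=> uF Ku; rewrite /block_proj; case: ifP => jF.
  rewrite (bigD1_seq j)//= proj_id// big1 ?addr0// => i ij.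
  by apply: proj_block0 Ku; apply/eqP.
rewrite big_seq big1// => i iF; apply: proj_block0 Ku => ij.
by move: jF; rewrite -ij iF.
Qed.

(** Approximate [u] by a vector [w] of the algebraic span. Once [A] contains the finitely many
    blocks of [w], [w] is fixed, and contractivity leaves an error of at most twice the distance
    from [u] to [w]. *)
Lemma cvg_block_proj u :
  block_proj (A : {fset I}) u @[A --> @summability.totally I] --> u.
Proof.
apply/cvg_nrmP => e e0; have e20 : 0 < e / 2 by rewrite divr_gt0.
have : closure (lin_span (\bigcup_i K i)) u by case: decK => _ _ ->.
move=> /closure_nrmP/(_ _ e20)[w [n [c [v [hv wE]]]] hw].
have /choice[f hf] : forall k, exists i, K i (v k).
  by move=> k; have [i _ Ki] := hv k; exists i.
exists [fset f k | k in 'I_n]%fset => // A /= hA.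
have lA := bounded_lin (block_proj_bounded A).
have uA : uniq A by exact: fset_uniq.
have Aw : block_proj A w = w.
  rewrite wE lin_sum//; apply: eq_bigr => k _; rewrite linZ// (block_proj_block uA (hf k)).
  by rewrite (fsubsetP hA)//; apply/imfsetP; exists k.
have -> : u - block_proj A u = (u - w) - block_proj A (u - w).
  by rewrite linB// Aw opprB addrA subrK.
apply: le_trans (nrmD _ _) _; rewrite nrmN.
have := block_proj_nrm (u - w) uA; lra.
Qed.

Lemma partial_sumE (V : zmodType) (f : I -> V) (A : {fset I}) :
  summability.partial_sum f A = \sum_(i <- A) f i.
Proof. by rewrite /summability.partial_sum big_seq_fsetE. Qed.

(** The bound involves [block_proj F u] and not just [u]: it becomes small when [F] avoids a large
    finite set, which makes the sums defining [block_exp] Cauchy. *)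
Lemma block_sum_nrm x C (F : seq I) u : uniq F -> 0 <= C -> (forall u, nrm (x u) <= C * nrm u) ->
  nrm (\sum_(i <- F) p i (x (p i u))) <= C * nrm (block_proj F u).
Proof.
move=> uF C0 hC.
rewrite -(@ler_pXn2r _ 2)// ?nnegrE ?mulr_ge0 ?nrm_ge0// exprMn.
rewrite /block_proj !pythagoras_sum// => [|i j _ _|i j _ _]; try exact: proj_orth.
rewrite mulr_sumr; apply: ler_sum => i _; rewrite -exprMn.
rewrite ler_pXn2r// ?nnegrE ?mulr_ge0 ?nrm_ge0//.
apply: le_trans (hC _).
by have := block_proj_nrm (x (p i u)) (isT : uniq [:: i]); rewrite /block_proj big_seq1.
Qed.

Lemma fset_split_sum (V : zmodType) (f : I -> V) (A B : {fset I}) : (A `<=` B)%fset ->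
  \sum_(i <- B) f i = \sum_(i <- A) f i + \sum_(i <- (B `\` A)%fset) f i.
Proof.
move=> AB; rewrite -big_cat; apply: perm_big; apply: uniq_perm => //.
  rewrite cat_uniq !fset_uniq/= andbT; apply/hasPn => i; rewrite inE => /andP[].
  by move=> /negbTE /= ->.
move=> i; rewrite mem_cat inE; case: (boolP (i \in A)) => //= iA.
by rewrite (fsubsetP AB).
Qed.

Lemma block_exp_cvg x u : bounded x ->
  (\sum_(i <- (A : {fset I})) p i (x (p i u))) @[A --> @summability.totally I] --> block_exp K x u.
Proof.
move=> [lx [C C0 hC]].
have -> : (fun A : {fset I} => \sum_(i <- A) p i (x (p i u))) =
    summability.partial_sum (fun i => p i (x (p i u))).
  by apply/funext => A; rewrite partial_sumE.
rewrite /block_exp /summability.sum.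
apply: cauchy_cvg; apply: cauchy_exP => eps /complex_gt0[e0 ->].
set e := complex.Re eps in e0 *.
have B0 : 0 < 2 * C + 1 by lra.
(* Two residuals of this size add up to [e / (2 * C + 1)], and multiplication by [C] keeps the
   result below [e]. *)
have d0 : 0 < e / (2 * C + 1) / 2 by rewrite !divr_gt0.
have /cvg_nrmP/(_ _ d0)[A0 _ hA0] := @cvg_block_proj u.
exists (summability.partial_sum (fun i => p i (x (p i u))) A0).
exists A0 => // A /= A0A; rewrite -ball_normE /= nrmE ltcR nrmB !partial_sumE.
rewrite (fset_split_sum _ A0A) addrAC subrr add0r.
apply: le_lt_trans (block_sum_nrm u (fset_uniq _) C0 hC) _.
have -> : block_proj (A `\` A0)%fset u = (u - block_proj A0 u) - (u - block_proj A u).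
  rewrite opprB addrC addrA subrK /block_proj (fset_split_sum _ A0A).
  by rewrite addrAC subrr add0r.
have h1 := hA0 A0 (fsubset_refl _); have h2 := hA0 A A0A; rewrite /= in h1 h2.
have h3 : nrm ((u - block_proj A0 u) - (u - block_proj A u)) <= e / (2 * C + 1).
  by apply: le_trans (nrmD _ _) _; rewrite nrmN; lra.
apply: le_lt_trans (ler_wpM2l C0 h3) _.
by rewrite mulrA ltr_pdivrMr// mulrC ltr_pM2l//; lra.
Qed.

Lemma block_exp_bounded x : bounded x -> bounded (block_exp K x).
Proof.
move=> bx; have [lx [C C0 hC]] := bx; split=> [a u v|].
  apply: (cvg_lim_eq (block_exp_cvg bx)).
  apply: (eq_cvg_fun _ (cvgD (cvg_scale a (@block_exp_cvg x u bx)) (@block_exp_cvg x v bx))) => A.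
  rewrite scaler_sumr -big_split /=; apply: eq_bigr => i _.
  by rewrite (proj_lin i) lx (proj_lin i).
exists C => // u; apply: (cvg_nrm_le (@block_exp_cvg x u bx)); near=> A.
apply: le_trans (block_sum_nrm u (fset_uniq _) C0 hC) _.
by apply: ler_wpM2l => //; apply: block_proj_nrm; exact: fset_uniq.
Unshelve. all: by end_near. Qed.

(** Together with [block_op_ext] this reduces linearity, the bimodule property and the identity on N
    to computations with a single projection. *)
Lemma block_expE x i u : bounded x -> K i u -> block_exp K x u = p i (x u).
Proof.
move=> bx Ku; apply: (cvg_lim_eq (@block_exp_cvg x u bx)).
apply: cvg_near_cst; exists [fset i]%fset => // A /= iA.
have {}iA : i \in A by rewrite (fsubsetP iA) ?inE.
rewrite (bigD1_seq i) ?fset_uniq//= big1 ?addr0 => [|j ji].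
  by rewrite (proj_id Ku).
rewrite (proj_block0 _ Ku); last exact/eqP.
by rewrite (lin0 (bounded_lin bx)) (lin0 (proj_lin j)).
Qed.

Lemma block_diagonalP x : block_diagonal K x <-> bounded x /\ (forall i u, K i u -> K i (x u)).
Proof. by split=> [[/bounded_opsP]|[/bounded_opsP]]. Qed.

Lemma proj_comm x i u : block_diagonal K x -> p i (x u) = x (p i u).
Proof.
move=> /block_diagonalP[bx xK].
suff e : p i \o x = x \o p i by exact: (congr1 (@^~ u) e).
apply: block_op_ext => [||j v Kv /=]; try by apply: bounded_comp => //; exact: proj_bounded.
rewrite (proj_block _ Kv) (proj_block _ (xK _ _ Kv)).
by case: eqP => // _; rewrite (lin0 (bounded_lin bx)).
Qed.

Lemma block_proj_comm x F u : block_diagonal K x -> block_proj F (x u) = x (block_proj F u).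
Proof.
move=> Nx; have /block_diagonalP[bx _] := Nx.
rewrite /block_proj (lin_sum (bounded_lin bx)).
by apply: eq_bigr => i _; rewrite proj_comm.
Qed.

Lemma block_bases : exists B : I -> set H, forall i, orthonormal_basis (K i) (B i).
Proof.
have h i : exists B, orthonormal_basis (K i) B by have [B [_ [hB _ _]]] := dimK i i; exists B.
by have [B hB] := boolp.choice h; exists B.
Qed.

(** Bases of the blocks are united and enumerated. The last clause lets basis vectors label the
    nonzero blocks, as [pair_enum] requires. *)
Lemma adapted_basis : exists c, [/\ onseq c, determining (range c),
  (forall n, c n <> 0 -> exists i, K i (c n)) &
  (forall i u, K i u -> u <> 0 -> exists2 n, c n <> 0 & K i (c n))].
Proof.
have [B hB] := block_bases.
have KB i b : B i b -> K i b by case: (hB i) => BK _ _ _; exact: BK.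
have [] := @orthonormal_enum R H sepH (\bigcup_i B i).
- by move=> b [i _ Bb]; case: (hB i) => _ h _ _; exact: h.
- move=> b b' [i _ Bb] [j _ Bb'] bb'; case: (eqVneq i j) => [ij|/eqP ij].
    by case: (hB i) => _ _ h _; apply: h; rewrite // ij.
  by apply: (block_orth ij); exact: KB.
move=> c [hc cB Bc _]; exists c; split=> //.
- move=> V x y bx by_ h; apply: block_op_ext => // i u Ku.
  apply: (bounded_eq bx by_ (A := B i)); last by case: (hB i) => _ _ _ ->.
  by move=> b Bb; have [|n <-] := Bc b; [exists i|apply: h; exists n].
- by move=> n n0; case: (cB n) => // -[i _ Bn]; exists i; exact: KB.
- move=> i u Ku u0; apply: contrapT => hn; apply: u0.
  apply: (@bounded_eq R H H (B i) id (fun=> 0)) => //.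
  + exact: bounded_id.
  + exact: bounded0.
  + move=> b Bb; exfalso; apply: hn.
    have [|n nb] := Bc b; first by exists i.
    exists n; last by rewrite nb; exact: KB.
    rewrite nb => b0; case: (hB i) => _ /(_ b Bb) + _ _.
    by rewrite b0 dot0l => /eqP; rewrite eq_sym oner_eq0.
  + by case: (hB i) => _ _ _ ->.
Qed.

(** Both maps are partial isometries between enumerated bases of the two blocks, in opposite
    directions, so their composite is the projection onto [K i]. Equality of the dimensions of
    distinct blocks enters here; elsewhere [dimK i i] merely supplies a basis of [K i]. *)
Lemma block_isometry i j : exists u y : H -> H,
  [/\ bounded u, bounded y, forall v, K j (y v) & forall v, u (y v) = p i v].
Proof.
have [B [C [c [d [hB hC hcd [cB Bc] [dC Cd]]]]]] := same_dim_pairseq sepH (dimK i j).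
have hdc := pairseq_sym hcd; have [hc hd _] := hcd.
exists (partial_isom d c), (partial_isom c d); split.
- exact: partial_isom_bounded.
- exact: partial_isom_bounded.
- move=> v; apply: partial_isom_closed => //; first exact: block_closed.
  move=> n; have [CK _ _ _] := hC.
  by case: (dC n) => [->|/CK//]; exact: block0.
- by move=> v; rewrite (partial_isom_comp _ hcd hdc) (orthoproj_onseq (block_closed i) hB hc cB Bc).
Qed.

Lemma adjoint_ex (x : H -> H) : bounded x -> exists2 y, bounded y & adjoint x y.
Proof.
by have [c [hc dc _ _]] := adapted_basis; exact: adjoint_exists hc dc.
Qed.

(** * The von Neumann algebras and the conditional expectation *)

Lemma vn_bounded_ops : von_neumann_algebra (bounded_ops H).
Proof.
split=> // [x /bounded_opsP/adjoint_ex[y /bounded_opsP by_ xy]|]; first by exists y.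
apply/seteqP; split=> [x [] //|x bx]; split=> // y [_ hy].
by rewrite hy.
Qed.

Lemma proj_commutant i : commutant (block_diagonal K) (p i).
Proof.
split; first exact/bounded_opsP/proj_bounded.
by move=> x Nx; apply/funext => u /=; exact: proj_comm.
Qed.

(** The projections [p i] lie in the commutant, so an element of the bicommutant commutes with them
    and preserves the blocks. The adjoint [y] preserves [K i] because, for [u] in [K i], the part of
    [y u] outside [K i] is orthogonal to every block. *)
Lemma vn_block_diagonal : von_neumann_algebra (block_diagonal K).
Proof.
split=> [x [] //|x /block_diagonalP[bx xK]|].
  have [y by_ xy] := adjoint_ex bx; exists y => //; apply/block_diagonalP; split=> // i u Ku.
  suff -> : y u = p i (y u) by exact: proj_in.
  apply/eqP; rewrite -subr_eq0; apply/eqP/dotxx_eq0.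
  set w := y u - p i (y u).
  have b1 := @bounded_dotl R H H id w (@bounded_id R H).
  suff e : (fun v => dot v w : R[i]^o) = (fun=> 0) by exact: (congr1 (@^~ w) e).
  apply: (block_op_ext b1); first exact: bounded0.
  move=> j v Kv /=; rewrite /w dotBr -xy -proj_adj (proj_block _ Kv).
  case: eqP => [ij|ij]; first by rewrite -xy subrr.
  by rewrite dot0l subr0; apply: (block_orth (i := j) (j := i)) => //; [move=> ji; apply: ij|exact: xK].
apply/seteqP; split=> x.
  move=> [bx hx]; split=> // i u Ku.
  have /(congr1 (@^~ u)) /= := hx _ (proj_commutant i).
  by rewrite (proj_id Ku) => ->; exact: proj_in.
move=> Nx; split; first by case: Nx.
by move=> y [_ hy]; rewrite hy.
Qed.

Lemma block_exp_linear : linear_on (bounded_ops H) (block_exp K).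
Proof.
move=> a x y /bounded_opsP bx /bounded_opsP by_.
have bxy := boundedP a bx by_.
apply: block_op_ext.
- exact: block_exp_bounded.
- by apply: boundedP; exact: block_exp_bounded.
move=> i u Ku; rewrite (block_expE bxy Ku) /= !fctE (block_expE bx Ku) (block_expE by_ Ku).
exact: (proj_lin i).
Qed.

Lemma block_exp_into : maps_into (bounded_ops H) (block_diagonal K) (block_exp K).
Proof.
move=> x /bounded_opsP bx; apply/block_diagonalP; split; first exact: block_exp_bounded.
by move=> i u Ku; rewrite (block_expE bx Ku); exact: proj_in.
Qed.

Lemma block_exp_id x : block_diagonal K x -> block_exp K x = x.
Proof.
move=> /block_diagonalP[bx xK]; apply: block_op_ext => //; first exact: block_exp_bounded.
by move=> i u Ku; rewrite (block_expE bx Ku) proj_id//; exact: xK.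
Qed.

Lemma block_exp_bimodule : bimodule_map (bounded_ops H) (block_diagonal K) (block_exp K).
Proof.
move=> a b x Na Nb /bounded_opsP bx.
have /block_diagonalP[ba aK] := Na; have /block_diagonalP[bb bK] := Nb.
have baxb : bounded (a \o x \o b) by apply: bounded_comp => //; apply: bounded_comp.
apply: block_op_ext; first exact: block_exp_bounded.
  by apply: bounded_comp => //; apply: bounded_comp => //; exact: block_exp_bounded.
move=> i u Ku; rewrite (block_expE baxb Ku) /= (block_expE bx (bK _ _ Ku)).
exact: proj_comm.
Qed.

Lemma block_exp_positive (x : H -> H) : bounded x -> positive x -> positive (block_exp K x).
Proof.
move=> bx px u; apply: (cvg_ge0 (cvg_dotl (y := u) (@block_exp_cvg x u bx))).
near=> A; rewrite dot_suml sumr_ge0// => i _.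
by rewrite proj_adj; exact: px.
Unshelve. all: by end_near. Qed.

(** On a vector [u] of a block, [dot (x u) u] equals [dot (block_exp K x u) u = 0], and positivity
    of [x] turns this into [x u = 0]. *)
Lemma block_exp_faithful (x : H -> H) : bounded x -> positive x -> block_exp K x = 0 -> x = 0.
Proof.
move=> bx px Ex; apply: block_op_ext => //; first exact: bounded0.
move=> i u Ku; apply: (positive_eq0 (bounded_lin bx) px).
by rewrite -{2}(proj_id Ku) -proj_adj -(block_expE bx Ku) Ex dot0l.
Qed.

Lemma block_exp_dot (x : H -> H) i j u v : bounded x -> K i u -> K j v ->
  dot (block_exp K x u) v = if i == j then dot (x u) v else 0.
Proof.
move=> bx Ku Kv; rewrite (block_expE bx Ku) proj_adj (proj_block _ Kv).
by case: eqP; rewrite ?dot0r.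
Qed.

(** A nonzero block is labelled by the position [g i] of a basis vector in it; distinct blocks are
    orthogonal, so labels do not collide. Zero blocks are left out: there may be uncountably many of
    them. [q] decodes the positions in use. *)
Lemma pair_enum : exists (q : nat -> option (nat * I)) (G : nat * I -> nat),
  ocancel q G /\ forall n i u, K i u -> u <> 0 -> q (G (n, i)) = Some (n, i).
Proof.
have [c [hc _ _ cK]] := adapted_basis.
pose nz i := exists2 m, c m <> 0 & K i (c m).
pose g i := if pselect (nz i) is left h then projT1 (cid2 h) else 0%N.
have gP i : nz i -> c (g i) <> 0 /\ K i (c (g i)).
  by rewrite /g; case: pselect => // h _; case: cid2.
pose G (t : nat * I) := choice.pickle (t.1, g t.2).
have Ginj t t' : nz t.2 -> nz t'.2 -> G t = G t' -> t = t'.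
  case: t t' => [n i] [n' i'] /= /gP[c0 Ki] /gP[_ Ki'].
  move=> /(pcan_inj (@choice.pickleK _))[-> gg]; congr pair.
  apply/eqP; apply: contrapT => /negP/eqP ii'; apply: c0; apply: dotxx_eq0.
  by apply: (block_orth ii') => //; rewrite gg.
pose q m := if pselect (exists2 t : nat * I, nz t.2 & G t = m) is left h
  then Some (projT1 (cid2 h)) else None.
exists q, G; split=> [m|n i u Ku u0].
  by rewrite /q; case: pselect => //= h; case: cid2.
have nzi : nz i by have [m m0 Km] := cK i u Ku u0; exists m.
rewrite /q; case: pselect => [h|[]]; last by exists (n, i).
by congr Some; case: cid2 => t nt Gt /=; apply: Ginj.
Qed.

Local Notation l2T := (l2 predT H).

Lemma block_spread : exists (W : l2T -> l2T) (G : nat * I -> nat),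
  [/\ bounded W,
      forall n i u, K i u -> W (delta n u) = delta (G (n, i)) u &
      forall t t' u u', K t.2 u -> K t'.2 u' -> u <> 0 -> u' <> 0 -> G t = G t' -> t = t'].
Proof.
have [q [G [qG Gq]]] := pair_enum.
pose w (f : l2T) m : H := if q m is Some t then p t.2 (f t.1) else 0.
have w_le (f : l2T) M : \sum_(0 <= m < M) nrm (w f m) ^+ 2 <= nrm f ^+ 2.
  pose s := pmap q (iota 0 M).
  have -> : \sum_(0 <= m < M) nrm (w f m) ^+ 2 = \sum_(t <- s) nrm (p t.2 (f t.1)) ^+ 2.
    rewrite /s /index_iota subn0; elim: (iota 0 M) => [|m r IH]; first by rewrite !big_nil.
    rewrite big_cons IH /= {1}/w; case: (q m) => [t|] /=; first by rewrite big_cons.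
    by rewrite nrm0 expr0n add0r.
  have us : uniq s by apply: (pmap_uniq qG); exact: iota_uniq.
  pose N := (\max_(t <- s) t.1).+1; pose r := undup (map snd s).
  (* The finitely many pairs met so far are enclosed in a rectangle, whose rows can be summed one at
     a time. *)
  apply: (@le_trans _ _ (\sum_(t <- [seq (n, i) | n <- iota 0 N, i <- r]) nrm (p t.2 (f t.1)) ^+ 2)).
    apply: ler_sum_subset => //.
    - by apply: allpairs_uniq => [||[? ?] [? ?] _ _ []-> ->//]; rewrite ?iota_uniq ?undup_uniq.
    - move=> [n i] ns; apply/allpairsP; exists (n, i); split=> //.
        by rewrite mem_iota /= add0n ltnS; exact: (leq_bigmax_seq _ ns).
      by rewrite mem_undup; apply/mapP; exists (n, i).
    - by move=> t; exact: sqr_ge0.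
  rewrite big_allpairs /=; apply: (le_trans _ (l2_partial f N)).
  rewrite /index_iota subn0; apply: ler_sum => n _.
  by apply: block_Bessel; exact: undup_uniq.
have w_in (f : l2T) : w f \in l2pred predT (H := H).
  by apply/asboolP; split=> //; exists (nrm f ^+ 2).
pose W (f : l2T) : l2T := L2 (w_in f).
have WE f m : W f m = w f m by [].
exists W, G; split.
- split=> [a f g|].
    apply: l2_ext => m _; rewrite l2valD l2valZ !WE /w; case: (q m) => [t|].
      by rewrite l2valD l2valZ (proj_lin t.2).
    by rewrite scaler0 addr0.
  exists 1 => // f; rewrite mul1r; apply: l2_nrm_le => [|N]; first exact: nrm_ge0.
  exact: w_le.
- move=> n i u Ku; apply: l2_ext => m _; rewrite WE deltaE// /w.
  case: (eqVneq u 0) => [u0|/eqP u0].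
    case: (q m) => [t|]; last by rewrite u0 if_same.
    by rewrite deltaE// u0 !if_same (lin0 (proj_lin t.2)).
  case: eqP => [->|mG]; first by rewrite (Gq n i u Ku u0) /= delta_diag// proj_id.
  case qm : (q m) => [[n' i']|//] /=; rewrite deltaE//; case: eqP => [n'n|_].
    rewrite (proj_block0 _ Ku)// => i'i; apply: mG.
    by have := qG m; rewrite qm /= n'n i'i => <-.
  exact: (lin0 (proj_lin i')).
- move=> [n i] [n' i'] u u' /= Ku Ku' u0 u'0 GG; apply/Some_inj.
  by rewrite -(Gq n i u Ku u0) GG (Gq n' i' u' Ku' u'0).
Qed.

(** By linearity and continuity in each argument, single entries from blocks suffice. There the left
    side is [dot (x u) u'] if [n = n'] and [i = i'], and 0 otherwise; the right side has the
    condition [G (n, i) = G (n', i')], which is the same by injectivity when [u] and [u'] are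
    nonzero. *)
Lemma amp_block_exp_dot (W : l2T -> l2T) (G : nat * I -> nat) x (f g : l2T) :
  bounded W -> (forall n i u, K i u -> W (delta n u) = delta (G (n, i)) u) ->
  (forall t t' u u', K t.2 u -> K t'.2 u' -> u <> 0 -> u' <> 0 -> G t = G t' -> t = t') ->
  bounded x -> dot (amp (block_exp K x) f) g = dot (amp x (W f)) (W g).
Proof.
move=> bW WG Ginj bx; have bE := block_exp_bounded bx.
suff key n i u n' i' u' : K i u -> K i' u' ->
    dot (amp (block_exp K x) (delta n u : l2T)) (delta n' u' : l2T) =
    dot (amp x (W (delta n u))) (W (delta n' u')).
  have bAE := @amp_bounded R predT H _ bE; have bAx := @amp_bounded R predT H _ bx.
  suff e : (fun f => dot (amp (block_exp K x) f) g : R[i]^o) = (fun f => dot (amp x (W f)) (W g) : R[i]^o).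
    exact: (congr1 (@^~ f) e).
  apply: (l2_eq_delta (bounded_dotl g bAE)
    (bounded_dotl (W g) (bounded_comp bAx bW)) blocks_total) => n u _ [i _ Ku].
  rewrite [LHS]dotC [RHS]dotC; congr (Num.conj _).
  suff e : (fun g => dot g (amp (block_exp K x) (delta n u : l2T)) : R[i]^o)
      = (fun g => dot (W g) (amp x (W (delta n u))) : R[i]^o).
    exact: (congr1 (@^~ g) e).
  apply: (l2_eq_delta (bounded_dotl _ (@bounded_id R l2T)) (bounded_dotl _ bW) blocks_total).
  move=> n' u' _ [i' _ Ku'].
  by rewrite [LHS]dotC [RHS]dotC (key n i u n' i' u' Ku Ku').
move=> Ku Ku'; rewrite (WG n i u Ku) (WG n' i' u' Ku') !amp_delta// !dot_delta//.
rewrite !deltaE//; have lx := bounded_lin bx; have lE := bounded_lin bE.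
case: (eqVneq u 0) => [->|/eqP u0].
  by rewrite (lin0 lx) (lin0 lE) !if_same dot0l.
case: (eqVneq u' 0) => [->|/eqP u'0]; first by rewrite !dot0r.
have Gnn := Ginj (n, i) (n', i') u u' Ku Ku' u0 u'0.
case: (eqVneq n' n) => [nn|nn]; last first.
  rewrite dot0l; case: eqP => [GG|_]; last by rewrite dot0l.
  by have [n1 _] := Gnn (esym GG); rewrite n1 eqxx in nn.
rewrite nn (block_exp_dot bx Ku Ku'); case: (eqVneq i i') => [->|ii]; first by rewrite eqxx.
case: eqP => [GG|_]; last by rewrite dot0l.
by have [_ i1] := Gnn (esym (etrans (congr1 (fun k => G (k, i')) nn) GG)); rewrite i1 eqxx in ii.
Qed.

Lemma l2_of_square_summable (u : nat -> H) : square_summable u ->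
  exists f : l2T, u = f.
Proof.
move=> /square_summableP hu.
have uP : u \in l2pred predT (H := H) by apply/asboolP; split.
by exists (L2 uP).
Qed.

Lemma square_summable_l2 (f : l2T) : square_summable f.
Proof. by apply/square_summableP; exact: l2_bounded. Qed.

(* continuity for the sigma-weak topology follows from mapping its defining
   functionals to functionals of the same kind *)
Lemma normal_map_pullback (Phi : (H -> H) -> H -> H) (W : l2T -> l2T) :
  (forall x, bounded x -> bounded (Phi x)) ->
  (forall x (f g : l2T), bounded x -> dot (amp (Phi x) f) g = dot (amp x (W f)) (W g)) ->
  normal_map (bounded_ops H) Phi.
Proof.
move=> bPhi hPhi F x FF FM /bounded_opsP bx hF u v.
move=> /l2_of_square_summable[f ->] /l2_of_square_summable[g ->].
have e y : bounded y -> limn (series (fun n => (dot (Phi y (f n)) (g n) : R[i]^o))) =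
   limn (series (fun n => (dot (y (W f n)) (W g n) : R[i]^o))).
  move=> by_; have := hPhi y f g by_; rewrite !l2_dotE.
  have -> : (fun n => (dot (amp (Phi y) f n) (g n) : R[i]^o)) = fun n => dot (Phi y (f n)) (g n).
    by apply/funext => n; rewrite ampE//; exact: bPhi.
  have -> // : (fun n => (dot (amp y (W f) n) (W g n) : R[i]^o)) = fun n => dot (y (W f n)) (W g n).
  by apply/funext => n; rewrite ampE.
rewrite (e x bx).
pose psi (f g : l2T) (y : H -> H) : R[i]^o :=
  limn (series (fun n => (dot (y (f n)) (g n) : R[i]^o))).
have h : psi (W f) (W g) y @[y --> F] --> psi (W f) (W g) x.
  by apply: hF; exact: square_summable_l2.
suff : (psi f g \o Phi) y @[y --> F] --> psi (W f) (W g) x by [].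
apply: cvg_trans h; apply: near_eq_cvg.
by apply: filterS FM => y /bounded_opsP by_; exact/esym/e.
Qed.

Lemma block_exp_normal : normal_map (bounded_ops H) (block_exp K).
Proof.
have [W [G [bW WG Ginj]]] := block_spread.
apply: (@normal_map_pullback _ W) => [x|x f g bx]; first exact: block_exp_bounded.
exact: amp_block_exp_dot WG Ginj bx.
Qed.

Lemma block_exp_cond_exp :
  faithful_normal_cond_exp (bounded_ops H) (block_diagonal K) (block_exp K).
Proof.
split.
- exact: block_exp_linear.
- exact: block_exp_into.
- exact: block_exp_id.
- exact: block_exp_bimodule.
- by move=> x /bounded_opsP; exact: block_exp_positive.
- by move=> x /bounded_opsP; exact: block_exp_faithful.
- exact: block_exp_normal.
Qed.

End Blocks.

(** * The state and its GNS representation *)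

Section WeightedState.
Context {R : realType} {H : hilbertType R}.
Variable c : nat -> H.
Hypothesis onc : onseq c.
Hypothesis detc : determining (range c).

Let S : pred nat := fun n => c n != 0.
Local Notation L := (l2 S H).

Definition weighted n : H := ((2^-1 ^+ n)%:C : R[i]) *: c n.

Lemma weighted_eq0 n : ~~ S n -> weighted n = 0.
Proof. by rewrite negbK /weighted => /eqP->; rewrite scaler0. Qed.

Lemma weighted_orth n m : n != m -> dot (weighted n) (weighted m) = 0.
Proof. by move=> nm; rewrite dotZl dotZr onc.1// !mulr0. Qed.

Lemma weighted_dot_neq0 n : S n -> dot (weighted n) (weighted n) != 0.
Proof.
move=> Sn; apply/eqP => /dotxx_eq0/eqP; rewrite scaler_eq0 (negbTE Sn) orbF.
by rewrite (inj_eq (@complexI R) _ 0) expf_eq0 invr_eq0 pnatr_eq0 andbF.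
Qed.

(** The squared norm of the n-th entry is at most 4^-n, hence at most 2^-n, and the geometric sums
    stay below 2. *)
Lemma weighted_l2 : weighted \in l2pred S (H := H).
Proof.
apply/asboolP; split=> [n|]; first exact: weighted_eq0.
have geo N : \sum_(0 <= n < N) (2^-1 : R) ^+ n = 2 - 2 * 2^-1 ^+ N.
  elim: N => [|N IH]; first by rewrite big_geq// expr0; ring.
  by rewrite big_nat_recr//= IH exprS; field.
have h0 n : 0 <= (2^-1 : R) ^+ n by rewrite exprn_ge0// invr_ge0.
exists 2 => N; apply: (@le_trans _ _ (\sum_(0 <= n < N) (2^-1 : R) ^+ n)); last first.
  by rewrite geo gerBl mulr_ge0.
apply: ler_sum => n _; rewrite nrmZ nrm_real ger0_norm// exprMn.
have h1 : (2^-1 : R) ^+ n <= 1 by rewrite exprn_ile1 ?invr_ge0// invf_le1 ?ler1n.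
have h2 : nrm (c n) ^+ 2 <= 1.
  by case: (onseq_nrm n onc) => [->|->]; rewrite ?nrm0 ?expr0n ?expr1n// ler01.
rewrite -[leRHS]mulr1; apply: ler_pM => //; rewrite ?sqr_ge0//.
by rewrite expr2 ger_pMl// lt_neqAle h0 andbT eq_sym expf_neq0// invr_eq0.
Qed.

Definition cyclic_vec : L := L2 weighted_l2.
Local Notation Omega := cyclic_vec.

Definition weighted_state (x : H -> H) : R[i] :=
  limn (series (fun n => (dot (x (weighted n)) (weighted n) : R[i]^o))).
Local Notation phi := weighted_state.

Lemma weighted_stateE x : bounded x -> phi x = dot (amp x Omega) Omega.
Proof.
move=> bx; rewrite l2_dotE /phi.
have -> // : (fun n => (dot (amp x Omega n) (Omega n) : R[i]^o)) =
  fun n => dot (x (weighted n)) (weighted n).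
by apply/funext => n; rewrite ampE.
Qed.

(** The cyclic vector is separating: [x] kills each [weighted n], hence each [c n], and these are
    total. Faithfulness of the state rests on this. *)
Lemma amp_cyclic_inj x : bounded x -> amp x Omega = 0 -> x = 0.
Proof.
move=> bx h; apply: detc => // [|_ [n _ <-]]; first exact: bounded0.
have [Sn|/negPn/eqP->] := boolP (S n); last by rewrite (lin0 (bounded_lin bx)).
have : amp x Omega n = 0 by rewrite h.
rewrite ampE//; have -> : Omega n = weighted n by [].
rewrite (linZ (bounded_lin bx)) => /eqP.
rewrite scaler_eq0 (inj_eq (@complexI R) _ 0) expf_eq0 invr_eq0 pnatr_eq0 andbF.
by move=> /eqP.
Qed.

Lemma weighted_state_fnp : faithful_normal_positive_functional (bounded_ops H) phi.
Proof.
split.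
- move=> a x y /bounded_opsP bx /bounded_opsP by_.
  rewrite !weighted_stateE//; last exact: boundedP.
  by rewrite amp_linear// dotPl.
- by move=> x /bounded_opsP bx px; rewrite weighted_stateE//; exact: amp_positive.
- move=> x /bounded_opsP bx px; rewrite weighted_stateE// => h.
  apply: amp_cyclic_inj => //.
  apply: positive_eq0 h; last exact: amp_positive.
  exact/bounded_lin/amp_bounded.
(* The state is itself one of the functionals defining the sigma-weak topology, with both sequences
   equal to [weighted]. *)
- move=> F x FF FM Mx hF; apply: hF; apply/square_summableP.
    exact: (l2_bounded Omega).
  exact: (l2_bounded Omega).
Qed.

(** For [c n] nonzero it sends [weighted n] to [a] and every other [weighted m] to 0. Sums of such
    operators carry the cyclic vector to any finitely supported sequence. *)
Definition rank_one n (a u : H) : H :=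
  (dot u (weighted n) / dot (weighted n) (weighted n)) *: a.

Lemma rank_one_bounded n a : bounded (rank_one n a).
Proof.
split=> [b u v|]; first by rewrite /rank_one dotPl mulrDl -mulrA scalerDl scalerA.
exists (nrm (weighted n) * nrm ((dot (weighted n) (weighted n))^-1 : R[i]^o) * nrm a) => [|u].
  by rewrite !mulr_ge0// nrm_ge0.
rewrite nrmZ nrmM [leRHS]mulrAC.
apply: ler_wpM2r; first exact: nrm_ge0.
rewrite [leRHS]mulrAC; apply: ler_wpM2r; first exact: nrm_ge0.
by rewrite mulrC; exact: dot_CauchySchwarz.
Qed.

Lemma rank_oneE n a m : S n -> rank_one n a (weighted m) = if m == n then a else 0.
Proof.
move=> Sn; rewrite /rank_one; case: eqVneq => [->|mn].
  by rewrite divff ?scale1r// weighted_dot_neq0.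
by rewrite weighted_orth// mul0r scale0r.
Qed.

Lemma amp_rank_one (f : L) N :
  amp (\sum_(0 <= n < N | S n) rank_one n (f n)) Omega = trunc f N.
Proof.
apply: l2_ext => m Sm; rewrite ampE; last first.
  by rewrite -big_filter; apply: bounded_sum => n; exact: rank_one_bounded.
rewrite /trunc l2val_sum fct_sumE; apply: eq_bigr => n Sn.
by rewrite deltaE// rank_oneE.
Qed.

Lemma cyclic_vec_dense : closure [set amp x Omega | x in bounded_ops H] = setT.
Proof.
apply/seteqP; split=> // f _; apply/closure_nrmP => e e0.
have /cvg_nrmP/(_ _ e0)/filter_ex[N hN] := @cvg_trunc R S H f.
exists (trunc f N) => //; exists (\sum_(0 <= n < N | S n) rank_one n (f n)).
  apply/bounded_opsP; rewrite -big_filter; apply: bounded_sum => n; exact: rank_one_bounded.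
exact: amp_rank_one.
Qed.

(** Transparent, because the space, the representation and the vector of this triple are later
    identified by conversion with [L], [amp] and [Omega]. *)
Definition weighted_gns : GNS (bounded_ops H) phi.
Proof.
exists L (amp (S := S)) Omega.
- by move=> x /bounded_opsP bx; apply/bounded_opsP; exact: amp_bounded.
- by move=> a x y /bounded_opsP bx /bounded_opsP by_; exact: amp_linear.
- exact: amp_id.
- by move=> x y /bounded_opsP bx /bounded_opsP by_; exact: amp_comp.
- by move=> x y /bounded_opsP bx /bounded_opsP by_; exact: amp_adjoint.
- by move=> x /bounded_opsP bx; rewrite weighted_stateE.
- exact: cyclic_vec_dense.
Defined.

End WeightedState.

(** * Compressions *)

Section OperatorNorm.
Context {R : realType} {H : hilbertType R}.

Lemma opnorm_ge (x : H -> H) u : bounded x -> nrm u <= 1 -> nrm (x u) <= opnorm x.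
Proof.
move=> [lx [C C0 hC]] u1; apply: ub_le_sup; last first.
  by exists u => //; rewrite /= nrmE lecR.
exists C => _ [v /= v1 <-]; apply: le_trans (hC v) _.
by rewrite -[leRHS]mulr1 ler_wpM2l//; move: v1; rewrite nrmE lecR.
Qed.

Lemma opnorm_le (x : H -> H) (B : R) :
  (forall u, nrm u <= 1 -> nrm (x u) <= B) -> opnorm x <= B.
Proof.
move=> hB; apply: ge_sup.
  by exists (complex.Re `|x 0|), 0 => //=; rewrite normr0 ler01.
by move=> _ [u /= u1 <-]; apply: hB; move: u1; rewrite nrmE lecR.
Qed.

End OperatorNorm.

Section Compression.
Context {R : realType} {H : hilbertType R} {I : choiceType} (K : I -> set H).
Hypothesis sepH : separable H.
Hypothesis decK : orthogonal_decomposition K.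
Hypothesis dimK : forall i j, same_dim (K i) (K j).
Variable c : nat -> H.
Hypothesis onc : onseq c.
Hypothesis cK : forall n, c n <> 0 -> exists i, K i (c n).

Local Notation p i := (orthoproj (K i)).
Local Notation N := (block_diagonal K).
Let S : pred nat := fun n => c n != 0.
Local Notation L := (l2 S H).
Local Notation w := (weighted c).
Local Notation Omega := (cyclic_vec onc).
Local Notation phi := (weighted_state c).
Local Notation gns := (weighted_gns onc).

Let pB i : bounded (p i) := proj_bounded sepH decK dimK i.
Let p_lin i : linear (p i) := bounded_lin (pB i).

Let w_block n : S n -> exists i, K i (w n).
Proof.
move=> /eqP/cK[i Ki]; exists i; have [K0 KP _] := block_closed decK i.
by rewrite /weighted -[_ *: _]addr0; exact: KP.
Qed.

Definition compression (F : {fset I}) (x : H -> H) : H -> H :=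
  block_proj K F \o x \o block_proj K F.

Let PF (F : {fset I}) : bounded (block_proj K F) := block_proj_bounded sepH decK dimK F.

Lemma compression_bounded F x : bounded x -> bounded (compression F x).
Proof. by move=> bx; apply: bounded_comp => //; exact: bounded_comp. Qed.

Lemma amp_compression (S' : pred nat) F x (f : l2 S' H) : bounded x ->
  amp (compression F x) f = amp (block_proj K F) (amp x (amp (block_proj K F) f)).
Proof.
move=> bx; rewrite /compression (amp_comp _ (bounded_comp (PF F) bx) (PF F)).
by rewrite (amp_comp _ (PF F) bx).
Qed.

Lemma block_proj_weighted (F : {fset I}) n :
  block_proj K F (w n) = w n \/ block_proj K F (w n) = 0.
Proof.
have [Sn|Sn] := boolP (S n); last first.
  by left; rewrite weighted_eq0// (lin0 (bounded_lin (PF F))).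
have [i Ki] := w_block Sn; rewrite (block_proj_block sepH decK dimK (fset_uniq F) Ki).
by case: ifP; [left|right].
Qed.

Lemma compression_linear F : linear_on (bounded_ops H) (compression F).
Proof.
move=> a x y _ _; apply/funext => u; rewrite /compression /= !fctE /=.
exact: (bounded_lin (PF F)).
Qed.

Lemma compression_normal F : normal_map (bounded_ops H) (compression F).
Proof.
apply: (@normal_map_pullback R H _ (amp (block_proj K F))) => [x|x f g bx].
  exact: compression_bounded.
rewrite amp_compression//; apply: (amp_adjoint (PF F) (PF F)).
exact: block_proj_adj.
Qed.

(** Self-adjointness of p_F moves it onto the vectors: the compressed matrix at [u] is the original
    one at the vectors p_F [u i]. *)
Lemma compression_cp F : completely_positive (bounded_ops H) (compression F).
Proof.
move=> n X _ hX u; have := hX (fun i => block_proj K F (u i)).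
congr (_ <= _); apply: eq_bigr => i _; apply: eq_bigr => j _.
by rewrite /compression /= (block_proj_adj sepH decK dimK).
Qed.

Lemma compression_opnorm F x : bounded x -> opnorm (compression F x) <= opnorm x.
Proof.
move=> bx; apply: opnorm_le => u u1; rewrite /compression /=.
apply: le_trans (block_proj_nrm sepH decK dimK _ (fset_uniq F)) _.
apply: opnorm_ge => //; apply: le_trans u1.
exact: (block_proj_nrm sepH decK dimK _ (fset_uniq F)).
Qed.

Lemma compression_bimodule F : bimodule_map (bounded_ops H) N (compression F).
Proof.
move=> a b x Na Nb _; apply/funext => u; rewrite /compression /=.
have cm := @block_proj_comm R H I K sepH decK dimK.
by rewrite (cm a F _ Na) (cm b F _ Nb).
Qed.

(** Since [w n] lies in a single block, p_F either fixes or kills it. Each term of the difference of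
    the two states is therefore 0 or [dot (x (w n)) (w n)], which is nonnegative. *)
Lemma compression_contractive F x : bounded x -> positive x ->
  phi (compression F x) <= phi x.
Proof.
move=> bx px; have bF := compression_bounded F bx.
rewrite !(weighted_stateE onc)// -subr_ge0.
apply: (cvg_ge0 (cvgB (@cvg_l2_dot _ _ _ (amp x Omega) Omega)
  (@cvg_l2_dot _ _ _ (amp (compression F x) Omega) Omega))).
near=> M; rewrite /series /= -sumrB sumr_ge0// => n _; rewrite !ampE//.
have -> : Omega n = w n by [].
rewrite /compression /= (block_proj_adj sepH decK dimK).
case: (block_proj_weighted F n) => ->; first by rewrite subrr.
by rewrite dot0r subr0; exact: px.
Unshelve. all: by end_near. Qed.

Lemma block_exp_state x : bounded x -> phi (block_exp K x) = phi x.
Proof.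
move=> bx; rewrite /weighted_state.
have -> // : (fun n => (dot (block_exp K x (w n)) (w n) : R[i]^o)) = fun n => dot (x (w n)) (w n).
apply/funext => n; have [Sn|Sn] := boolP (S n).
  have [i Ki] := w_block Sn.
  by rewrite (block_exp_dot sepH decK dimK bx Ki Ki) eqxx.
by rewrite weighted_eq0// !dot0r.
Qed.

(** On a truncation only finitely many entries are involved, and each converges by [cvg_block_proj];
    contractivity of the amplified projections controls the rest uniformly in [A]. *)
Lemma cvg_amp_block_proj (f : L) :
  amp (block_proj K (A : {fset I})) f @[A --> @summability.totally I] --> f.
Proof.
apply/cvg_nrmP => e e0; have e30 : 0 < e / 3 by rewrite divr_gt0.
have /cvg_nrmP/(_ _ e30)/filter_ex[M hM] := @cvg_trunc R S H f.
have ct : amp (block_proj K (A : {fset I})) (trunc f M) @[A --> @summability.totally I] --> trunc f M.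
  apply: (eq_cvg_fun (g := fun A : {fset I} => \sum_(0 <= n < M | S n) delta n (block_proj K A (f n)))).
    move=> A; rewrite /trunc (lin_sum (bounded_lin (@amp_bounded R S H _ (PF A)))).
    by apply: eq_bigr => n Sn; rewrite amp_delta.
  apply: cvg_sum_seq => n _; apply: bounded_cvg; first exact: delta_bounded.
  exact: cvg_block_proj.
have /cvg_nrmP/(_ _ e30) := ct; apply: filterS => A hA.
have bA := @amp_bounded R S H _ (PF A).
have -> : f - amp (block_proj K A) f = (f - trunc f M) +
    (trunc f M - amp (block_proj K A) (trunc f M)) - amp (block_proj K A) (f - trunc f M).
  by rewrite (linB (bounded_lin bA)) addrA subrK opprB addrA subrK.
apply: le_trans (nrmD _ _) _; rewrite nrmN.
have h1 := nrmD (f - trunc f M) (trunc f M - amp (block_proj K A) (trunc f M)).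
have h2 : nrm (amp (block_proj K A) (f - trunc f M)) <= 1 * nrm (f - trunc f M).
  apply: amp_nrm_le => // [|u]; first exact: bounded_lin.
  by rewrite mul1r; exact: (block_proj_nrm sepH decK dimK _ (fset_uniq A)).
by lra.
Qed.

Lemma compression_strong x (f : L) : bounded x ->
  amp (compression A x) f @[A --> @summability.totally I] --> amp x f.
Proof.
move=> bx; have [lx [C C0 hC]] := bx.
apply/cvg_nrmP => e e0.
have B0 : 0 < C + 1 by lra.
have e1 : 0 < e / 2 by rewrite divr_gt0.
have e2 : 0 < e / 2 / (C + 1) by rewrite divr_gt0.
have /cvg_nrmP/(_ _ e2) h1 := @cvg_amp_block_proj f.
have /cvg_nrmP/(_ _ e1) h2 := @cvg_amp_block_proj (amp x f).
apply: filterS (filterI h1 h2) => A [{}h1 {}h2].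
have bA := @amp_bounded R S H _ (PF A); have bAx := @amp_bounded R S H _ bx.
rewrite (amp_compression A f bx); set q := amp (block_proj K A) in h1 h2 bA *.
have -> : amp x f - q (amp x (q f)) = (amp x f - q (amp x f)) + q (amp x (f - q f)).
  by rewrite (linB (bounded_lin bAx)) (linB (bounded_lin bA)) addrA subrK.
apply: le_trans (nrmD _ _) _.
have h3 : nrm (q (amp x (f - q f))) <= 1 * nrm (amp x (f - q f)).
  apply: amp_nrm_le => // [|u]; first exact: bounded_lin.
  by rewrite mul1r; exact: (block_proj_nrm sepH decK dimK _ (fset_uniq A)).
have h4 : nrm (amp x (f - q f)) <= C * nrm (f - q f) by exact: amp_nrm_le.
have h5 : C * nrm (f - q f) <= e / 2.
  apply: (@le_trans _ _ ((C + 1) * (e / 2 / (C + 1)))).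
    by apply: ler_pM; rewrite ?nrm_ge0// lerDl.
  by rewrite mulrC mulfVK// gt_eqF.
rewrite [leRHS](splitr e); apply: lerD h2 _; apply: le_trans h3 _.
by rewrite mul1r; exact: le_trans h4 h5.
Qed.

(** On [S] this is the block containing [w n]. Outside [S] the choice is arbitrary, as 0 lies in
    every block, but there the sequences in [L] vanish. *)
Definition block_index n : option I :=
  if pselect (exists i, K i (w n)) is left h then Some (projT1 (cid h)) else None.

Lemma block_indexP n : S n -> exists2 i, block_index n = Some i & K i (w n).
Proof.
move=> /w_block h; rewrite /block_index; case: pselect => // h'.
by exists (projT1 (cid h')) => //; case: cid.
Qed.

Lemma diag_in (f : L) : (fun n => oapp (fun i => p i (f n)) 0 (block_index n)) \in l2pred S (H := H).
Proof.
apply/asboolP; split=> [n Sn|].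
  by rewrite l2_supp//; case: block_index => //= i; rewrite (lin0 (p_lin i)).
exists (nrm f ^+ 2) => M; apply: le_trans (l2_partial f M); apply: ler_sum => n _.
rewrite ler_pXn2r// ?nnegrE ?nrm_ge0//; case: block_index => [i|] /=; last by rewrite nrm0 nrm_ge0.
by have := block_proj_nrm sepH decK dimK (f n) (isT : uniq [:: i]); rewrite /block_proj big_seq1.
Qed.

(** This is the Jones projection e_N in coordinates: the closure of N Omega consists of the
    sequences whose n-th entry lies in the block of [w n]. *)
Definition diag_proj (f : L) : L := L2 (diag_in f).

Lemma diag_projE f n : diag_proj f n = oapp (fun i => p i (f n)) 0 (block_index n).
Proof. by []. Qed.

Lemma diag_proj_bounded : bounded diag_proj.
Proof.
split=> [a f g|].
  apply: l2_ext => n _; rewrite l2valD l2valZ !diag_projE l2valD l2valZ.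
  by case: block_index => [i|] /=; [exact: p_lin|rewrite scaler0 addr0].
exists 1 => // f; rewrite mul1r; apply: l2_nrm_le => [|M]; first exact: nrm_ge0.
apply: le_trans (l2_partial f M); apply: ler_sum => n _; rewrite diag_projE.
rewrite ler_pXn2r// ?nnegrE ?nrm_ge0//; case: block_index => [i|] /=; last by rewrite nrm0 nrm_ge0.
by have := block_proj_nrm sepH decK dimK (f n) (isT : uniq [:: i]); rewrite /block_proj big_seq1.
Qed.

Lemma rank_one_block n a i : S n -> K i (w n) -> K i a -> N (rank_one c n a).
Proof.
move=> Sn Kw Ka; apply/block_diagonalP; split; first exact: rank_one_bounded.
move=> j u Ku; rewrite /rank_one; have [K0 KP _] := block_closed decK j.
rewrite -[_ *: _]addr0; case: (eqVneq i j) => [ij|/eqP ij].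
  by apply: KP => //; rewrite -ij.
by rewrite (dot_sym0 (block_orth decK ij Kw Ku)) mul0r scale0r addr0.
Qed.

(** The n-th entry lies in the block of [w n], so the rank-one operator that produces it from [w n]
    is block-diagonal. Hence every truncation already belongs to N Omega. *)
Lemma diag_proj_closure f : closure [set amp x Omega | x in N] (diag_proj f).
Proof.
apply/closure_nrmP => e e0.
have /cvg_nrmP/(_ _ e0)/filter_ex[M hM] := @cvg_trunc R S H (diag_proj f).
exists (trunc (diag_proj f) M) => //.
exists (\sum_(0 <= n < M | S n) rank_one c n (diag_proj f n)); last first.
  exact: amp_rank_one.
apply/block_diagonalP; split.
  by rewrite -big_filter; apply: bounded_sum => n; exact: rank_one_bounded.
move=> i u Ku; rewrite fct_sumE; have [K0 KP _] := block_closed decK i.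
elim/big_ind: _ => // [x y Kx Ky|n Sn]; first by rewrite -[x]scale1r; exact: KP.
have [j jn Kj] := block_indexP Sn.
have /block_diagonalP[_] : N (rank_one c n (diag_proj f n)).
  by apply: (rank_one_block Sn Kj); rewrite diag_projE jn /=; exact: proj_in.
exact.
Qed.

Lemma diag_proj_residual f g : closure [set amp x Omega | x in N] g ->
  dot (f - diag_proj f) g = 0.
Proof.
move=> /(closure_bounded (B := [set 0 : R[i]^o]) (x := fun g => dot g (f - diag_proj f) : R[i]^o)
  (bounded_dotl _ (@bounded_id R L))) h.
have : closure [set 0 : R[i]^o] (dot g (f - diag_proj f)).
  apply: h => _ [x /block_diagonalP[bx xK] <-]; apply: dot_sym0.
  apply: (cvg_lim_eq (V := R[i]^o) (@cvg_l2_dot R S H (f - diag_proj f) (amp x Omega))).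
  rewrite (_ : series _ = fun=> 0); first exact: cvg_cst.
  apply/funext => M; rewrite /series /= big1// => n _.
  rewrite l2valB diag_projE ampE//; have -> : Omega n = w n by [].
  have [Sn|Sn] := boolP (S n); last first.
    by rewrite weighted_eq0// (lin0 (bounded_lin bx)) dot0r.
  have [j -> Kj] /= := block_indexP Sn.
  rewrite dotBl (proj_adj sepH decK dimK) (proj_id sepH decK dimK) ?subrr//.
  exact: xK.
move=> /closure_nrmP h0; apply: dot_sym0; apply: (@nrm_eq0 R R[i]^o).
apply/eqP; rewrite eq_le nrm_ge0 andbT; apply/ler_addgt0Pr => e e0.
by have [_ -> +] := h0 e e0; rewrite subr0 add0r.
Qed.

Lemma jones_projE : jones_proj N (L := gns) = diag_proj.
Proof.
apply/funext => f; apply: orthoprojP; first exact: diag_proj_closure.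
by move=> g; exact: diag_proj_residual.
Qed.

Lemma compression_implementation F : exists2 T : L -> L,
  bounded T /\ (forall x, bounded x -> T (amp x Omega) = amp (compression F x) Omega) &
  K00 N (L := gns) T.
Proof.
have [u hu] := boolp.choice (fun t : I * I => block_isometry sepH decK dimK t.1 t.2).
have [y huy] := boolp.choice hu.
have bu t : bounded (u t) by case: (huy t).
have by_ t : bounded (y t) by case: (huy t).
have yK t v : K t.2 (y t v) by case: (huy t).
have uy t v : u t (y t v) = p t.1 v by case: (huy t).
pose T t : L -> L := amp (u t) \o diag_proj \o amp (y t).
pose s : seq (I * I) := [seq (i, j) | i <- F, j <- F].
have bT t : bounded (T t).
  apply: bounded_comp; last exact: amp_bounded.
  by apply: bounded_comp; [exact: amp_bounded|exact: diag_proj_bounded].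
exists (\sum_(t <- s) T t).
  split=> [|x bx]; first exact: bounded_sum.
  apply: l2_ext => n Sn; rewrite fct_sumE l2val_sum.
  rewrite ampE; last exact: compression_bounded.
  have -> : Omega n = w n by [].
  have [i0 ni0 Ki0] := block_indexP Sn.
  (* At position [n] the Jones projection keeps the component in the block [i0] of [w n]. As [y t]
     takes its values in [K t.2], either everything survives, and [u t] brings it back to [p t.1],
     or nothing does. *)
  have Tn t : T t (amp x Omega) n = if t.2 == i0 then p t.1 (x (w n)) else 0.
    rewrite /T /= ampE// diag_projE ni0 /= !ampE//.
    have -> : Omega n = w n by [].
    rewrite (proj_block sepH decK dimK _ (yK t _)) eq_sym; case: ifP => _ //.
    exact: (lin0 (bounded_lin (bu t))).
  under eq_bigr do rewrite Tn.
  rewrite /s big_allpairs /= /compression /=.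
  rewrite (block_proj_block sepH decK dimK (fset_uniq F) Ki0).
  case: ifP => i0F.
    apply: eq_bigr => i _; rewrite (bigD1_seq i0) ?fset_uniq//= eqxx big1 ?addr0//.
    by move=> j /negbTE->.
  rewrite (lin0 (bounded_lin bx)) (lin0 (bounded_lin (PF F))) big1// => i _.
  by rewrite big_seq big1// => j jF; case: eqP => // ji; move: i0F; rewrite -ji jF.
apply: (@lin_span_sum R (L -> L)) => t _.
exists (u t), (y t); split; [exact/bounded_opsP|exact/bounded_opsP|].
by rewrite jones_projE.
Qed.

Lemma rHAP_block_diagonal : rHAP (bounded_ops H) N phi.
Proof.
exists gns, {fset I}, (fun A B => A `<=` B)%fset, compression; split.
- split.
  + by constructor; exact: fset0.
  + by move=> A; exact: fsubset_refl.
  + by move=> A B C; exact: fsubset_trans.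
  + by move=> A B; exists (A `|` B)%fset; [exact: fsubsetUl|exact: fsubsetUr].
- exact: compression_linear.
- by move=> F x /bounded_opsP bx; apply/bounded_opsP; exact: compression_bounded.
- exact: compression_normal.
- exact: compression_cp.
- by exists 1 => F x /bounded_opsP bx; rewrite mul1r; exact: compression_opnorm.
- exact: compression_bimodule.
- move=> x f /bounded_opsP bx.
  have -> : tails (fun A B : {fset I} => A `<=` B)%fset = summability.totally.
    apply/seteqP; split=> P; first by move=> [A hA]; exists A.
    by move=> [A _ hA]; exists A.
  exact: compression_strong.
- by move=> F x /bounded_opsP bx px; exact: compression_contractive.
- move=> F; have [T [bT hT] KT] := compression_implementation F.
  exists T.
    split; first exact/bounded_opsP.
    by move=> x /bounded_opsP bx; exact: hT.
  split; first exact/bounded_opsP.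
  (* The operator already lies in the algebraic span, so it approximates itself. *)
  move=> e e0; exists T => //; rewrite subrr.
  by apply: le_lt_trans e0; apply: opnorm_le => f _; rewrite nrm0.
Qed.

End Compression.

Theorem theorem6p3 (R : realType) (H : hilbertType R) (I : choiceType)
    (K : I -> set H) :
  separable H ->
  orthogonal_decomposition K ->
  (forall i j, same_dim (K i) (K j)) ->
  relative_Haagerup_property (bounded_ops H) (block_diagonal K) (block_exp K).
Proof.
move=> sepH decK dimK; have [c [onc detc cK _]] := adapted_basis sepH decK dimK.
split.
- exact: vn_bounded_ops sepH decK dimK.
- exact: vn_block_diagonal.
- by move=> x [].
- exact: block_exp_cond_exp.
exists (weighted_state c); split.
- exact: weighted_state_fnp onc detc.
- by move=> x /bounded_opsP; exact: (block_exp_state sepH decK dimK cK).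
- exact: (rHAP_block_diagonal sepH decK dimK onc cK).
Qed.
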